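(* Consider the adaptive stochastic collocation algorithm SC described in the context, driven by either the workless profit or the profit with work, and let $(I_\ell)_\ell$ be the sequence of multi-index sets it generates. Then the a-posteriori error estimators vanish in the limit and the discrete solutions converge: $$\lim_{\ell\to\infty}\zeta_{SC,I_\ell}=0=\lim_{\ell\to\infty}\|u-S_{I_\ell}[u]\|_{L^\infty(\Gamma,V)} .$$
   Context: $\mathbb N=\{1,2,\dots\}$. Problem. $d\ge 2$; $D\subset\mathbb R^d$ a bounded domain with Lipschitz boundary; $N\in\mathbb N$; $\Gamma_1,\dots,\Gamma_N\subset\mathbb R$ compact intervals of positive length, $\Gamma=\Gamma_1\times\dots\times\Gamma_N$. $f\in L^2(D)$ and $a(y,x)=a_0(x)+\sum_{n=1}^N a_n(x)y_n$ with $0<a_{\min}\le a(y,x)\le a_{\max}$ for all $y\in\Gamma$, $x\in D$, and $\nabla a(y,\cdot)|_T\in L^\infty(T)$ for all elements $T$ of a coarse initial mesh $\mathcal T_{\rm init}$ of $D$. $V=H^1_0(D)$, $\|v\|_V=\|\nabla v\|_{L^2(D)}$. $u:\Gamma\to V$ is the solution of $\int_D a(y,x)\nabla u(y,x)\cdot\nabla v(x)\,dx=\int_D f v\,dx$ for all $v\in V$, $y\in\Gamma$. It is a known fact that there is $\tau\in\mathbb R_{>0}^N$ such that $u$ extends to a bounded holomorphic function on $\Sigma(\Gamma,\tau)=\{z\in\mathbb C^N:\mathrm{dist}(z_n,\Gamma_n)\le\tau_n\ \forall n\}$. $\nabla$ acts on $x$; $\|g\|_{L^\infty(\Gamma,X)}=\sup_{y\in\Gamma}\|g(y)\|_X$.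 Sparse grids. $m(0)=0$, $m(1)=1$, $m(i)=2^{i-1}+1$ for $i>1$. $\mathcal Y_n^{m}\subset\Gamma_n$ is the set of $m$ Clenshaw–Curtis nodes, i.e. $-\cos(\pi(j-1)/(m-1))$, $j=1,\dots,m$ (the point $0$ if $m=1$), mapped affinely from $[-1,1]$ to $\Gamma_n$. $\mathcal U_n^{m(i)}$ is Lagrange interpolation at $\mathcal Y_n^{m(i)}$ in the $n$-th variable, $\mathcal U_n^0=0$. For $i\in\mathbb N^N$: $\Delta^{m(i)}=\bigotimes_{n=1}^N(\mathcal U_n^{m(i_n)}-\mathcal U_n^{m(i_n-1)})$. A finite $I\subset\mathbb N^N$ is downward-closed if $i\in I$, $i_n>1$ imply $i-e_n\in I$. $S_I[v]=\sum_{i\in I}\Delta^{m(i)}v$. Margin: $\mathcal M_I=\{i\in\mathbb N^N\setminus I: i-e_n\in I\text{ for some }n\text{ with }i_n>1\}$. For $i\in\mathcal M_I$, $A_{i,I}$ is the smallest subset of $\mathcal M_I$ containing $i$ such that $I\cup A_{i,I}$ is downward-closed. Estimators and profits. $\zeta_{i,I}=\|\Delta^{m(i)}(a\nabla S_I[u])\|_{L^\infty(\Gamma,L^2(D))}$, $\zeta_{SC,I}=\sum_{i\in\mathcal M_I}\zeta_{i,I}$. Workless profit: $\mathcal P_{i,I}=\sum_{j\in A_{i,I}}\zeta_{j,I}$. Profit with work: $\mathcal P_{i,I}=\big(\sum_{j\in A_{i,I}}\zeta_{j,I}\big)/\big(\sum_{j\in A_{i,I}}W_j\big)$, $W_j=\prod_{n=1}^N(m(j_n)-m(j_n-1))$.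 Algorithm SC (run without stopping test; exact samples $u(y)$ available). $I_0=\{(1,\dots,1)\}$; for $\ell=0,1,\dots$ let $i_\ell$ maximize $\mathcal P_{i,I_\ell}$ over $i\in\mathcal M_{I_\ell}$ (ties: lexicographically first index) and set $I_{\ell+1}=I_\ell\cup A_{i_\ell,I_\ell}$. *)

(* Defs.v *)
From HB Require Import structures.
From mathcomp Require Export all_boot all_order all_algebra.
From mathcomp Require Export all_classical all_reals all_analysis.
Export Order.TTheory GRing.Theory Num.Theory.
Export numFieldNormedType.Exports.

Set Implicit Arguments.
Unset Strict Implicit.
Unset Printing Implicit Defensive.

Local Open Scope classical_set_scope.
Local Open Scope ring_scope.

(** * Lebesgue measure on R^d, by Caratheodory's construction *)

Section LebesgueOuter.
Context (R : realType) (d : nat).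
Implicit Types (q : 'rV[R]_d * 'rV[R]_d) (F : set ('rV[R]_d * 'rV[R]_d)).

(* a pair of corners stands for the closed box between them *)
Definition box q : set 'rV[R]_d :=
  [set x | forall i, q.1 0 i <= x 0 i <= q.2 0 i].

Definition box_volume q : \bar R :=
  (\prod_(i < d) Num.max 0 (q.2 0 i - q.1 0 i))%:E.

Definition box_cover (A : set 'rV[R]_d) F :=
  countable F /\ A `<=` \bigcup_(q in F) box q.

Definition lebesgue_outer (A : set 'rV[R]_d) : \bar R :=
  ereal_inf [set (\esum_(q in F) box_volume q)%E | F in box_cover A].

Local Open Scope ereal_scope.

Lemma box_volume_ge0 q : 0 <= box_volume q.
Proof.
by rewrite lee_fin; apply: prodr_ge0 => i _; rewrite le_max lexx.
Qed.

Lemma lebesgue_outer_ge0 A : 0 <= lebesgue_outer A.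
Proof.
apply: le_ereal_inf_tmp => _ [F _ <-].
by apply: esum_ge0 => q _; exact: box_volume_ge0.
Qed.

Lemma lebesgue_outer0 : lebesgue_outer set0 = 0.
Proof.
apply/eqP; rewrite eq_le lebesgue_outer_ge0 andbT.
apply: ereal_inf_lbound; exists set0; last by rewrite esum_set0.
by split=> //; exact: countable0.
Qed.

Lemma le_lebesgue_outer : {homo lebesgue_outer : A B / A `<=` B >-> A <= B}.
Proof.
move=> A B AB; apply/ereal_inf_le_tmp => x [F [cF BF] <-].
by exists F => //; split => //; apply: subset_trans AB BF.
Qed.

Lemma lebesgue_outer_sigma_subadditive : sigma_subadditive lebesgue_outer.
Proof.
move=> A; have [[i ioo]|] := pselect (exists i, lebesgue_outer (A i) = +oo).
  rewrite (eseries_pinfty _ _ ioo) ?leey// => n _.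
  by rewrite -ltNye (lt_le_trans _ (lebesgue_outer_ge0 _)).
rewrite -forallNE => Aoo.
suff add2e (e : {posnum R}) : lebesgue_outer (\bigcup_n A n) <=
    \sum_(i <oo) lebesgue_outer (A i) + e%:num%:E.
  by apply/lee_addgt0Pr => _/posnumP[].
rewrite (le_trans _ (epsilon_trick _ _ _))//; last first.
  by move=> n; exact: lebesgue_outer_ge0.
pose P n F := box_cover (A n) F /\
  \esum_(q in F) box_volume q <= lebesgue_outer (A n) + (e%:num / (2 ^ n.+1)%:R)%:E.
have [G PG] : {G : nat -> set ('rV[R]_d * 'rV[R]_d) & forall n, P n (G n)}.
  apply: (@choice _ _ P) => n.
  have en1 : (0 < e%:num / (2 ^ n.+1)%:R)%R by [].
  have fin : lebesgue_outer (A n) \is a fin_num.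
    by rewrite ge0_fin_numE ?lebesgue_outer_ge0// ltey; apply/eqP; exact: Aoo.
  have [_ [F cF <-] xS] := lb_ereal_inf_adherent en1 fin.
  by exists F; split => //; exact/ltW.
apply: (@le_trans _ _ (\esum_(q in \bigcup_n seqDU G n) box_volume q)).
  apply: ereal_inf_lbound; exists (\bigcup_n seqDU G n) => //.
  rewrite -seqDU_bigcup_eq; split.
    by apply: bigcup_countable => // n _; have [[]] := PG n.
  move=> x [n _ Anx]; have [[_ /(_ x Anx) [q Gq qx]] _] := PG n.
  by exists q => //; exists n.
rewrite esum_bigcupT//; last by move=> q; exact: box_volume_ge0.
rewrite -nneseries_esumT; last first.
  by move=> n; apply: esum_ge0 => q _; exact: box_volume_ge0.
apply: lee_nneseries => [n _ _|n _].
  by apply: esum_ge0 => q _; exact: box_volume_ge0.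
have [_] := PG n; apply: le_trans.
rewrite esum_mkcond [leRHS]esum_mkcond; apply: le_esum => q _.
case: ifPn => [/set_mem qS|_]; last by case: ifPn => // _; exact: box_volume_ge0.
by rewrite mem_set//; exact: subset_seqDU qS.
Qed.

HB.instance Definition _ := isOuterMeasure.Build R 'rV[R]_d lebesgue_outer
  lebesgue_outer0 lebesgue_outer_ge0 le_lebesgue_outer
  lebesgue_outer_sigma_subadditive.

Definition lebesgue_om : {outer_measure set 'rV[R]_d -> \bar R} :=
  lebesgue_outer.

(* 'rV[R]_d with the sigma-algebra of Lebesgue-measurable sets *)
Definition Rd := caratheodory_type lebesgue_om.

Definition leb : {measure set Rd -> \bar R} := lebesgue_om.

End LebesgueOuter.

(** * Function spaces on a domain of R^d *)

Section FunctionSpaces.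
Context (R : realType) (d : nat).
Implicit Types (D U : set 'rV[R]_d) (w f : 'rV[R]_d -> R)
  (g : 'rV[R]_d -> 'rV[R]_d).

Definition dotv (x y : 'rV[R]_d) : R := \sum_(i < d) x 0 i * y 0 i.

(* `|x| is the maximum norm on 'rV[R]_d; this is the Euclidean one *)
Definition norm2 (x : 'rV[R]_d) : R := Num.sqrt (dotv x x).

(* Near each boundary point, D is the part above the graph of a Lipschitz
   function over the hyperplane orthogonal to some unit vector nu; gam is only
   evaluated on that hyperplane. *)
Definition lipschitz_boundary D : Prop :=
  forall p, closure D p -> ~ interior D p ->
  exists (nu : 'rV[R]_d) (gam : 'rV[R]_d -> R),
    [/\ norm2 nu = 1,
        exists L : R, forall x y, `|gam x - gam y| <= L * norm2 (x - y)
      & \forall x \near p, D x <-> gam (x - dotv x nu *: nu) < dotv x nu].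

Definition bounded_lipschitz_domain D : Prop :=
  [/\ open D, connected D, D !=set0, bounded_set D & lipschitz_boundary D].

Definition lmeasurable_fun D w : Prop :=
  @measurable_fun _ _ (Rd R d) R D w.

(* extended-real valued: +oo when w is not square integrable over D *)
Definition L2norm D w : \bar R :=
  ('N[leb R d]_2%:E[EFin \o (w \_ D)])%E.

Definition L2normv D g : \bar R := L2norm D (norm2 \o g).

Definition L2 D w : Prop := lmeasurable_fun D w /\ (L2norm D w < +oo)%E.

Definition L2v D g : Prop := forall j : 'I_d, L2 D (fun x => g x 0 j).

Definition Linfty D w : Prop :=
  lmeasurable_fun D w /\
  exists M : R, {ae leb R d, forall x : Rd R d, D x -> `|w x| <= M}.

Definition partial (j : 'I_d) w : 'rV[R]_d -> R := 'D_(delta_mx 0 j) w.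

Definition gradient w : 'rV[R]_d -> 'rV[R]_d :=
  fun x => \row_j partial j w x.

(* C^oo: every iterated partial derivative is differentiable everywhere *)
Definition smooth w : Prop :=
  forall (s : seq 'I_d) x, differentiable (foldr partial w s) x.

Definition test_function D w : Prop :=
  [/\ smooth w, compact (closure [set x | w x != 0])
    & closure [set x | w x != 0] `<=` D].

(* w has a weak gradient on the open set U, all of whose components lie in
   L^oo(U) *)
Definition weak_gradient_Linfty U w : Prop :=
  exists2 g : 'rV[R]_d -> 'rV[R]_d,
    forall j, Linfty U (fun x => g x 0 j) &
    forall phi, test_function U phi -> forall j : 'I_d,
      (\int[leb R d]_(x in U) (w x * partial j phi x)%:E =
       - \int[leb R d]_(x in U) (g x 0 j * phi x)%:E)%E.

(* A partition of the closure of D into finitely many compact elements; their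
   shape is left free, so simplicial meshes are a special case. *)
Definition mesh D (Th : set (set 'rV[R]_d)) : Prop :=
  [/\ finite_set Th,
      forall T, Th T -> [/\ compact T, T !=set0 & T = closure (interior T)],
      forall T T', Th T -> Th T' -> T <> T' -> interior T `&` interior T' = set0
    & \bigcup_(T in Th) T = closure D].

(* A Sobolev function is carried together with its weak gradient: v.1 is the
   function and v.2 its gradient. *)
Definition sobolev : Type :=
  (('rV[R]_d -> R) * ('rV[R]_d -> 'rV[R]_d))%type.

(* H^1_0(D) is the closure in H^1(D) of the test functions, that is, the closure
   of the pairs (phi, grad phi) in L^2(D) x L^2(D)^d. As the gradient is a
   closable operator on test functions, v.1 determines v.2 almost everywhere. *)
Definition H10 D (v : sobolev) : Prop :=
  [/\ L2 D v.1, L2v D v.2 &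
    exists phi : nat -> 'rV[R]_d -> R,
      [/\ forall k, test_function D (phi k),
          L2norm D (fun x => phi k x - v.1 x) @[k --> \oo] --> 0%E
        & L2normv D (fun x => gradient (phi k) x - v.2 x) @[k --> \oo]
            --> 0%E]].

Definition Vnorm D (v : sobolev) : \bar R := L2normv D v.2.

End FunctionSpaces.

(** * Parametric diffusion problem *)

Section Problem.
Context (R : realType) (d N : nat).

(* n-th interval is [lo n, hi n] *)
Definition Gam (lo hi : 'I_N -> R) : set 'rV[R]_N :=
  [set y | forall n, lo n <= y 0 n <= hi n].

Definition coef (a0 : 'rV[R]_d -> R) (an : 'I_N -> 'rV[R]_d -> R)
    (y : 'rV[R]_N) (x : 'rV[R]_d) : R :=
  a0 x + \sum_(n < N) an n x * y 0 n.

Definition parametric_solution (D : set 'rV[R]_d) (G : set 'rV[R]_N)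
    (a : 'rV[R]_N -> 'rV[R]_d -> R) (f : 'rV[R]_d -> R)
    (u : 'rV[R]_N -> sobolev R d) : Prop :=
  forall y, G y -> H10 D (u y) /\
    forall v : sobolev R d, H10 D v ->
      (\int[leb R d]_(x in D) (a y x * dotv ((u y).2 x) (v.2 x))%:E =
       \int[leb R d]_(x in D) (f x * v.1 x)%:E)%E.

End Problem.

(** * Sparse grids *)

(* multi-indices in N^N with N = {1, 2, ...}; positivity of the entries is part
   of the definition of the margin below *)
Definition mindex (N : nat) := {ffun 'I_N -> nat}.

Definition level (i : nat) : nat :=
  if i is k.+1 then (if k is 0 then 1 else 2 ^ k + 1)%N else 0%N.

Section Interpolation.
Context (R : realType) (N : nat) (lo hi : 'I_N -> R) (X : lmodType R).
Implicit Types (v : 'rV[R]_N -> X) (y : 'rV[R]_N).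

(* j counts from 0 here *)
Definition cc_node (M j : nat) : R :=
  if M == 1%N then 0 else - cos (pi * j%:R / M.-1%:R).

Definition node (n : 'I_N) (M j : nat) : R :=
  (lo n + hi n) / 2 + (hi n - lo n) / 2 * cc_node M j.

Definition lagrange (n : 'I_N) (M : nat) (j : 'I_M) (t : R) : R :=
  \prod_(k < M | k != j) ((t - node n M k) / (node n M j - node n M k)).

Definition subst_coord y (n : 'I_N) (t : R) : 'rV[R]_N :=
  \row_k (if k == n then t else y 0 k).

(* Lagrange interpolation in the n-th variable; it is 0 for M = 0 *)
Definition interp (n : 'I_N) (M : nat) v : 'rV[R]_N -> X :=
  fun y => \sum_(j < M) lagrange n j (y 0 n) *: v (subst_coord y n (node n M j)).

(* the univariate operators act on different variables, so that their tensor
   product is their composition, in any order *)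
Definition Delta (i : mindex N) v : 'rV[R]_N -> X :=
  foldr (fun n w y => interp n (level (i n)) w y - interp n (level (i n).-1) w y)
    v (enum 'I_N).

Definition S_interp (I : set (mindex N)) v : 'rV[R]_N -> X :=
  fun y => \sum_(i \in I) Delta i v y.

End Interpolation.

Section MultiIndices.
Context (N : nat).
Implicit Types (I A : set (mindex N)) (i j : mindex N).

Definition decr i (n : 'I_N) : mindex N := [ffun k => (i k - (k == n))%N].

Definition down_closed I : Prop :=
  forall i, I i -> forall n : 'I_N, (1 < i n)%N -> I (decr i n).

Definition margin I : set (mindex N) :=
  [set i : mindex N | [/\ forall n : 'I_N, (0 < i n)%N, ~ I i
    & exists2 n : 'I_N, (1 < i n)%N & I (decr i n)]].

Definition completion I i : set (mindex N) :=
  smallest [set A | A `<=` margin I /\ down_closed (I `|` A)] [set i].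

Definition lex_lt i j : Prop :=
  exists n : 'I_N, (forall k : 'I_N, (k < n)%N -> i k = j k) /\ (i n < j n)%N.

Definition work (R : realType) j : R :=
  \prod_(n < N) (level (j n) - level (j n).-1)%N%:R.

End MultiIndices.

(** * Estimators, profits, and the adaptive algorithm *)

Section Adaptivity.
Context (R : realType) (d N : nat) (D : set 'rV[R]_d) (lo hi : 'I_N -> R)
  (a : 'rV[R]_N -> 'rV[R]_d -> R) (u : 'rV[R]_N -> sobolev R d).
Implicit Types (I : set (mindex N)) (i j : mindex N).

Definition S_u I : 'rV[R]_N -> sobolev R d := S_interp lo hi I u.

Definition flux I : 'rV[R]_N -> 'rV[R]_d -> 'rV[R]_d :=
  fun y x => a y x *: (S_u I y).2 x.

Definition zeta i I : \bar R :=
  ereal_sup [set L2normv D (Delta lo hi i (flux I) y) | y in Gam lo hi].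

Definition zeta_SC I : \bar R := (\sum_(i \in margin I) zeta i I)%E.

Definition error I : \bar R :=
  ereal_sup [set Vnorm D (u y - S_u I y) | y in Gam lo hi].

Definition workless_profit i I : \bar R :=
  (\sum_(j \in completion I i) zeta j I)%E.

Definition work_profit i I : \bar R :=
  (workless_profit i I * ((\sum_(j \in completion I i) work R j)^-1)%:E)%E.

Definition is_selected (P : mindex N -> set (mindex N) -> \bar R) I i : Prop :=
  margin I i /\
  forall j, margin I j -> j <> i ->
    (P j I < P i I)%E \/ (P j I = P i I /\ lex_lt i j).

Definition SC_sequence (P : mindex N -> set (mindex N) -> \bar R)
    (I : nat -> set (mindex N)) : Prop :=
  I 0%N = [set [ffun=> 1%N]] /\
  forall l, exists2 i, is_selected P (I l) i
    & I l.+1 = I l `|` completion (I l) i.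

End Adaptivity.

(* Main.v *)
(** The profit of the selected index is a sum of estimators over a set that is
    disjoint from all earlier selections, so it tends to zero as soon as the
    estimators are dominated by a summable family [zb] that does not depend on
    the index set; maximality of the profit then forces every estimator in the
    margin to zero, and dominated convergence gives the first limit.

    The family [zb] comes from the affine dependence of the coefficient on [y].
    As the detail operators are orthogonal idempotents and the nodes are nested,
    the detail [i] of [a * grad S_I u] involves only the details [i - e_n] of
    [grad u].  These decay exponentially in the number of nodes.  Instead of
    using holomorphy, the values of [u] at the finitely many sample points are
    compared with Richardson iterates in their own span: the iterates are
    polynomials in [y], hence are annihilated by the detail operator, and they
    converge geometrically and uniformly in [y].  The Lebesgue constants of the
    Clenshaw-Curtis nodes grow only polynomially.

    For the second limit, [a * grad S_I u] is the sum of its details over the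
    index set and its margin, and on the index set these agree with those of
    [a * grad u], whose divergence does not depend on [y].  So the residual is
    carried by the margin and the error is at most [zeta_SC / amin]. *)

From HB Require Import structures.
Require Import Defs.
From mathcomp Require Import measurable_realfun.
From mathcomp Require Import ring lra zify.

Set Implicit Arguments.
Unset Strict Implicit.
Unset Printing Implicit Defensive.

Local Open Scope classical_set_scope.
Local Open Scope ring_scope.

(** * Levels and Clenshaw-Curtis nodes *)

(** At a fixed [y] a detail is a finite combination of values [u(p)], and each value solves the
    equation at its own [p] tested against all the others. This finite linear system, written with
    Gram matrices, is all that the decay estimate needs; the error bound too tests the equation only
    with solutions.

    The obstacle in the decay estimate is that Lebesgue constants cost powers of [2 ^ i n] in all
    coordinates, while decay is gained in one coordinate at a time. Taking the largest coordinate
    settles this: the decay is exponential in the number of nodes, that is in [2 ^ i n], and absorbs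
    any fixed power. So [zb i] can be a multiple of the product of the [2^-1 ^+ i n].

    For the profit with work, the work of a completion is at most the total work below its index,
    whatever the step. This bound is not uniform in the index, which is why finitely many indices
    are split off before maximality is used. *)

Section CommutingFold.
Context (T : eqType) (E : Type) (O : T -> E -> E).
Hypothesis O_comm : forall n m v, n != m -> O n (O m v) = O m (O n v).

Lemma foldr_comm_pull k s v :
  k \notin s -> foldr O (O k v) s = O k (foldr O v s).
Proof.
elim: s => //= n s IH; rewrite inE negb_or => /andP[kn ks].
by rewrite IH// O_comm// eq_sym.
Qed.

(** Makes any chosen coordinate the outermost one in the fold that defines [Delta]. *)
Lemma foldr_comm_rem k s v :
  uniq s -> k \in s -> foldr O v s = O k (foldr O v (rem k s)).
Proof.
elim: s => //= n s IH /andP[ns us]; rewrite inE.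
have [-> //|/= nk] := eqVneq k n.
by move=> ks; rewrite IH//= O_comm// eq_sym.
Qed.

End CommutingFold.

Lemma foldr_eq_in (T : eqType) (E : Type) (O O' : T -> E -> E) s v :
  {in s, forall n w, O n w = O' n w} -> foldr O v s = foldr O' v s.
Proof.
elim: s => //= n s IH h; rewrite IH; first by rewrite h// mem_head.
by move=> m ms w; apply: h; rewrite inE ms orbT.
Qed.

Lemma ler_sum_subset (R : numDomainType) (T : eqType) (F : T -> R) (s t : seq T) :
  (forall x, 0 <= F x) -> uniq s -> uniq t -> {subset s <= t} ->
  \sum_(x <- s) F x <= \sum_(x <- t) F x.
Proof.
move=> F0 us ut st; rewrite [leRHS](bigID (mem s))/= -[leLHS]addr0 lerD ?sumr_ge0//.
rewrite -[leRHS]big_filter le_eqVlt; apply/orP; left; apply/eqP/perm_big.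
apply: uniq_perm; rewrite ?filter_uniq// => x; rewrite mem_filter.
by case xs : (x \in s) => //=; rewrite st.
Qed.

Lemma level_lt i : (level i < level i.+1)%N.
Proof.
case: i => [|[|i]] //=.
by rewrite ltn_add2r ltn_exp2l.
Qed.

Lemma level_le : {homo level : i j / (i <= j)%N}.
Proof. by apply: homo_leq => // [? ? ?|i]; [exact: leq_trans|exact/ltnW/level_lt]. Qed.

Lemma level_le_exp i : (level i <= 2 ^ i)%N.
Proof.
case: i => [|[|i]] //=; rewrite (expnS 2 i.+1) mul2n -addnn leq_add2l.
by rewrite expn_gt0.
Qed.

(** The shift by 2 collects two losses: [i] may exceed the underlying detail by one level, and a
    detail annihilates only the polynomials of the level before its own. *)
Lemma level_ge_exp i : (2 ^ i <= 8 * (level (i - 2)).+1)%N.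
Proof.
case: i => [|[|[|[|i]]]] //; rewrite !subSS subn0 /= !expnS; lia.
Qed.

Section SubstCoord.
Context (R : realType) (N : nat).
Implicit Types (y : 'rV[R]_N) (n m : 'I_N) (s t : R).

Lemma subst_coord_same y n t : (subst_coord y n t) 0 n = t.
Proof. by rewrite mxE eqxx. Qed.

Lemma subst_coord_other y n t m : m != n -> (subst_coord y n t) 0 m = y 0 m.
Proof. by rewrite mxE => /negbTE ->. Qed.

Lemma subst_coord_idem y n s t :
  subst_coord (subst_coord y n s) n t = subst_coord y n t.
Proof. by apply/rowP => k; rewrite !mxE; case: eqP. Qed.

Lemma subst_coord_id y n : subst_coord y n (y 0 n) = y.
Proof. by apply/rowP => k; rewrite !mxE; case: eqP => // ->. Qed.

Lemma subst_coordC y n m s t : n != m ->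
  subst_coord (subst_coord y n s) m t = subst_coord (subst_coord y m t) n s.
Proof.
move=> nm; apply/rowP => k; rewrite !mxE.
by case: (eqVneq k m) => [->|//]; rewrite eq_sym (negbTE nm).
Qed.

Lemma Gam_subst_coord (lo hi : 'I_N -> R) y n t :
  Gam lo hi y -> lo n <= t <= hi n -> Gam lo hi (subst_coord y n t).
Proof. by move=> Gy ht k; rewrite mxE; case: eqP => [->|_]. Qed.

End SubstCoord.

Section Nodes.
Context (R : realType) (N : nat) (lo hi : 'I_N -> R).
Hypothesis lohi : forall n, lo n < hi n.
Implicit Types (n : 'I_N).

Lemma cc_node_bound M j : (j < M)%N -> -1 <= @cc_node R M j <= 1.
Proof.
by move=> jM; rewrite /cc_node; case: eqP => _; rewrite ?cos_geN1 ?cos_le1 ?oppr_ge0 ?lerN10//=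
  ?ler01// lerN2 cos_le1 lerNl cos_geN1.
Qed.

Lemma node_bound n M j : (j < M)%N -> lo n <= node lo hi n M j <= hi n.
Proof.
move=> /cc_node_bound; rewrite /node; set c := cc_node _ _ _ => /andP[c1 c2].
have := lohi n; move: (lo n) (hi n) => a b ab; apply/andP; split; nra.
Qed.

Lemma cc_node_inj M j k : (j < M)%N -> (k < M)%N ->
  @cc_node R M j = cc_node R M k -> j = k.
Proof.
move=> jM kM; rewrite /cc_node; case: eqP => [M1 _|M1].
  by rewrite M1 in jM kM; case: j k jM kM => // [] [].
have M0 : 0 < M.-1%:R :> R by rewrite ltr0n; lia.
have mem i : (i < M)%N -> (pi * i%:R / M.-1%:R : R) \in `[0, pi]%R.
  move=> iM; rewrite in_itv/= divr_ge0 ?mulr_ge0 ?pi_ge0 ?ler0n//=.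
  rewrite ler_pdivrMr// ler_pM2l ?pi_gt0// ler_nat; lia.
move/oppr_inj/(cos_inj (mem _ jM) (mem _ kM)).
move/(mulIf (invr_neq0 (lt0r_neq0 M0)))/(mulfI (lt0r_neq0 (pi_gt0 R))).
by move/eqP; rewrite eqr_nat => /eqP.
Qed.

Lemma node_inj n M j k : (j < M)%N -> (k < M)%N ->
  node lo hi n M j = node lo hi n M k -> j = k.
Proof.
move=> jM kM; rewrite /node => /addrI/mulfI h; apply: (cc_node_inj jM kM).
by apply: h; rewrite mulf_neq0 ?invr_neq0 ?pnatr_eq0// subr_eq0 gt_eqF.
Qed.

Lemma cc_node_nested i i' j : (i <= i')%N -> (j < level i)%N ->
  exists2 j', (j' < level i')%N & cc_node R (level i') j' = cc_node R (level i) j.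
Proof.
move=> ii'; elim: i' ii' => [|i' IH]; first by rewrite leqn0 => /eqP->.
rewrite leq_eqVlt => /predU1P[<-|]; first by move=> ji; exists j.
rewrite ltnS => /IH {}IH /IH[k kl <-].
case: i' {IH} kl => [|[|i']] //=.
  (* The midpoint, alone at level 1, is the middle one of the three nodes of level 2. *)
  rewrite ltnS leqn0 => /eqP ->; exists 1%N => //.
  by rewrite /cc_node/= addn1/= mulr1 cos_pihalf oppr0.
(* The angular step is halved, so the index doubles. *)
move=> kl; exists (2 * k)%N.
  by move: kl; rewrite !addn1 !ltnS (expnS 2 i'.+1) leq_mul2l.
rewrite /cc_node; case: eqP => [|_]; first by rewrite !expnS; have := expn_gt0 2 i'; lia.
case: eqP => [|_]; first by rewrite !expnS; have := expn_gt0 2 i'; lia.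
rewrite !addn1/= (expnS 2 i'.+1) !natrM; congr (- cos _).
have : (2 ^ i'.+1)%:R != 0 :> R by rewrite pnatr_eq0 -lt0n expn_gt0.
by move: (_%:R) => x x0; field; rewrite x0.
Qed.

Lemma node_nested n i i' j : (i <= i')%N -> (j < level i)%N ->
  exists2 j', (j' < level i')%N &
    node lo hi n (level i') j' = node lo hi n (level i) j.
Proof.
by move=> ii' /(cc_node_nested ii')[j' jl e]; exists j' => //; rewrite /node e.
Qed.

Lemma lagrange_node n M (j k : 'I_M) :
  lagrange lo hi n j (node lo hi n M k) = (k == j)%:R.
Proof.
rewrite /lagrange; have [->|kj] := eqVneq k j.
  rewrite big1// => l lj; rewrite divff// subr_eq0; apply: contra_neq lj => /esym e.
  by apply: val_inj; apply: (node_inj _ _ e).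
by rewrite (bigD1 k)//= subrr !mul0r.
Qed.

Definition lagrange_poly n M (j : 'I_M) : {poly R} :=
  \prod_(k < M | k != j) ((node lo hi n M j - node lo hi n M k)^-1 *:
    ('X - (node lo hi n M k)%:P)).

Lemma horner_lagrange_poly n M (j : 'I_M) t :
  (lagrange_poly n j).[t] = lagrange lo hi n j t.
Proof.
rewrite horner_prod; apply: eq_bigr => k kj.
by rewrite hornerZ !hornerE mulrC.
Qed.

Lemma size_lagrange_poly n M (j : 'I_M) : (size (lagrange_poly n j) <= M)%N.
Proof.
apply: (leq_trans (size_poly_prod_leq _ _)); rewrite leq_subLR.
apply: (@leq_trans (\sum_(k < M | k != j) 2).+1).
  rewrite ltnS; apply: leq_sum => k _.
  by apply: (leq_trans (size_scale_leq _ _)); rewrite size_XsubC.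
rewrite sum_nat_const.
have -> : #|[pred k | k != j]| = M.-1.
  by rewrite (eq_card (B := predC1 j))// cardC1 card_ord.
have := ltn_ord j; lia.
Qed.

(** The two sides are polynomials in [t] of degree below [M] that agree at [M] distinct nodes. *)
Lemma sum_lagrange n M (p : {poly R}) t : (size p <= M)%N ->
  \sum_(j < M) lagrange lo hi n j t * p.[node lo hi n M j] = p.[t].
Proof.
move=> pM; pose q := \sum_(j < M) p.[node lo hi n M j] *: lagrange_poly n j - p.
suff q0 : q = 0.
  move: q0 => /subr0_eq e; rewrite -[in RHS]e.
  by rewrite horner_sum; apply: eq_bigr => j _; rewrite hornerZ horner_lagrange_poly mulrC.
apply: (@roots_geq_poly_eq0 _ _ [seq node lo hi n M (nat_of_ord k) | k <- enum 'I_M]).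
- apply/allP => _ /mapP[k _ ->]; rewrite /root /q hornerD hornerN horner_sum subr_eq0.
  rewrite (bigD1 k)//= big1 ?addr0.
    by rewrite hornerZ horner_lagrange_poly lagrange_node eqxx mulr1.
  by move=> j jk; rewrite hornerZ horner_lagrange_poly lagrange_node eq_sym (negbTE jk) mulr0.
- rewrite map_inj_uniq ?enum_uniq// => j k e.
  by apply: val_inj; apply: (node_inj _ _ e).
- rewrite size_map size_enum_ord (leq_trans (size_polyD _ _))// geq_max size_polyN pM andbT.
  apply: (leq_trans (size_sum _ _ _)); apply/bigmax_leqP => j _.
  exact: (leq_trans (size_scale_leq _ _)) (size_lagrange_poly _ _).
Qed.

End Nodes.

Local Arguments level : simpl never.

(** * Interpolation and detail operators *)

Section InterpOperators.
Context (R : realType) (N : nat) (lo hi : 'I_N -> R) (X : lmodType R).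
Hypothesis lohi : forall n, lo n < hi n.
Implicit Types (n m : 'I_N) (v w : 'rV[R]_N -> X) (y : 'rV[R]_N).

Local Notation U := (interp lo hi).

Definition mulcoord n v : 'rV[R]_N -> X := fun y => y 0 n *: v y.

Definition detail n i v : 'rV[R]_N -> X :=
  fun y => U n (level i) v y - U n (level i.-1) v y.

Lemma interp0 n v : U n 0 v = 0.
Proof. by apply/funext => y; rewrite /interp big_ord0. Qed.

Lemma interp_lin n M a v w : U n M (a *: v + w) = a *: U n M v + U n M w.
Proof.
apply/funext => y; transitivity (a *: U n M v y + U n M w y) => //.
rewrite /interp scaler_sumr -big_split; apply: eq_bigr => j _.
by rewrite /= [(a *: v + w) _]/(a *: v _ + w _) scalerDr !scalerA mulrC.
Qed.

Lemma detail_lin n i a v w : detail n i (a *: v + w) = a *: detail n i v + detail n i w.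
Proof.
apply/funext => y; rewrite /detail !interp_lin !fctE.
by rewrite scalerBr opprD addrACA.
Qed.

Lemma interpC n m M M' v : n != m -> U n M (U m M' v) = U m M' (U n M v).
Proof.
move=> nm; apply/funext => y; rewrite /interp.
under eq_bigr do rewrite scaler_sumr.
rewrite exchange_big; apply: eq_bigr => k _; rewrite scaler_sumr.
apply: eq_bigr => j _; rewrite !scalerA mulrC subst_coordC//.
by rewrite !subst_coord_other// eq_sym.
Qed.

Lemma interpB n M v w : U n M (v - w) = U n M v - U n M w.
Proof. by rewrite addrC -scaleN1r interp_lin scaleN1r addrC. Qed.

Lemma detailE n i v : detail n i v = U n (level i) v - U n (level i.-1) v.
Proof. by []. Qed.

Lemma detailC n m i j v : n != m -> detail n i (detail m j v) = detail m j (detail n i v).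
Proof.
move=> nm; rewrite !detailE !interpB !(interpC _ _ _ nm).
by rewrite !opprB addrACA [_ - _ + _]addrACA [- _ + _]addrC.
Qed.

Lemma interp_detailC n m M j v : n != m -> U n M (detail m j v) = detail m j (U n M v).
Proof. by move=> nm; rewrite !detailE !interpB !(interpC _ _ _ nm). Qed.

Lemma interp_mulcoord_other n m M v : n != m ->
  U n M (mulcoord m v) = mulcoord m (U n M v).
Proof.
move=> nm; apply/funext => y; rewrite /interp /mulcoord scaler_sumr.
by apply: eq_bigr => j _; rewrite subst_coord_other 1?eq_sym// !scalerA mulrC.
Qed.

Lemma mulcoordB n v w : mulcoord n (v - w) = mulcoord n v - mulcoord n w.
Proof. by apply/funext => y; rewrite /mulcoord !fctE scalerBr. Qed.

Lemma detail_mulcoord_other n m i v : n != m ->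
  detail n i (mulcoord m v) = mulcoord m (detail n i v).
Proof. by move=> nm; rewrite !detailE !interp_mulcoord_other// mulcoordB. Qed.

Lemma interp_at_node n M v y j : (j < M)%N -> y 0 n = node lo hi n M j -> U n M v y = v y.
Proof.
move=> jM yn; rewrite /interp (bigD1 (Ordinal jM))//= big1 ?addr0.
  by rewrite yn (lagrange_node lohi n (Ordinal jM) (Ordinal jM)) eqxx scale1r -yn subst_coord_id.
move=> k kj; rewrite yn (lagrange_node lohi n k (Ordinal jM)).
by rewrite eq_sym (negbTE kj) scale0r.
Qed.

Lemma interp_eq0 n M v y :
  (forall j, (j < M)%N -> v (subst_coord y n (node lo hi n M j)) = 0) -> U n M v y = 0.
Proof. by move=> h; apply: big1 => j _; rewrite h ?scaler0. Qed.

(* Degree less than [k] in the coordinate [n], the other coordinates being fixed. *)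
Definition polydeg n k v := forall y, exists2 s : seq ({poly R} * X),
  all (fun q : {poly R} * X => (size q.1 <= k)%N) s &
  forall t, v (subst_coord y n t) = \sum_(q <- s) q.1.[t] *: q.2.

Lemma polydeg_le n k k' v : (k <= k')%N -> polydeg n k v -> polydeg n k' v.
Proof.
move=> kk' h y; have [s sk e] := h y; exists s => //.
by apply/allP => q /(allP sk)/leq_trans; apply.
Qed.

Lemma polydeg_interp n M v : polydeg n M (U n M v).
Proof.
move=> y; exists [seq (lagrange_poly lo hi n j, v (subst_coord y n (node lo hi n M j))) |
  j <- enum 'I_M].
  by apply/allP => _ /mapP[j _ ->]; rewrite size_lagrange_poly.
move=> t; rewrite big_map big_enum; apply: eq_bigr => j _ /=.
by rewrite horner_lagrange_poly subst_coord_same subst_coord_idem.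
Qed.

Lemma interp_polydeg n M v : polydeg n M v -> U n M v = v.
Proof.
move=> h; apply/funext => y; have [s sM e] := h y.
rewrite -[in RHS](subst_coord_id y n) e /interp.
under eq_bigr do rewrite e scaler_sumr.
rewrite exchange_big big_seq [RHS]big_seq; apply: eq_bigr => q /(allP sM) qM.
rewrite -(sum_lagrange lohi n (y 0 n) qM) scaler_suml.
by apply: eq_bigr => j _; rewrite scalerA.
Qed.

Lemma polydeg_mulcoord n k v : polydeg n k v -> polydeg n k.+1 (mulcoord n v).
Proof.
move=> h y; have [s sM e] := h y; exists [seq ('X * q.1, q.2) | q <- s].
  apply/allP => _ /mapP[q /(allP sM) qk ->] /=.
  by rewrite (leq_trans (size_polyMleq _ _))// size_polyX.
move=> t; rewrite /mulcoord subst_coord_same e scaler_sumr big_map.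
by apply: eq_bigr => q _; rewrite hornerM hornerX scalerA.
Qed.

Lemma polydeg_mulcoord_other n m k v : m != n -> polydeg n k v -> polydeg n k (mulcoord m v).
Proof.
move=> mn h y; have [s sM e] := h y; exists [seq (q.1, y 0 m *: q.2) | q <- s].
  by apply/allP => _ /mapP[q /(allP sM) qk ->].
move=> t; rewrite /mulcoord subst_coord_other// e scaler_sumr big_map.
by apply: eq_bigr => q _; rewrite !scalerA mulrC.
Qed.

Lemma polydeg_add n k v w : polydeg n k v -> polydeg n k w -> polydeg n k (v + w).
Proof.
move=> hv hw y; have [s sM e] := hv y; have [s' sM' e'] := hw y.
exists (s ++ s'); first by rewrite all_cat sM.
by move=> t; rewrite big_cat/= fctE e e'.
Qed.

Lemma polydeg_sum n k (J : Type) (r : seq J) (F : J -> 'rV[R]_N -> X) :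
  (forall j, polydeg n k (F j)) -> polydeg n k (\sum_(j <- r) F j).
Proof.
move=> h; elim/big_ind : _ => // [|v w]; last exact: polydeg_add.
by move=> y; exists [::] => // t; rewrite big_nil.
Qed.

Lemma polydeg_cst n k (x : X) : polydeg n k.+1 (fun=> x).
Proof.
move=> y; exists [:: (1, x)]; first by rewrite /= size_poly1.
by move=> t; rewrite big_seq1 hornerC scale1r.
Qed.

Lemma interp_level_le n i j v : (i <= j)%N -> U n (level i) (U n (level j) v) = U n (level i) v.
Proof.
move=> ij; apply/funext => y; apply: eq_bigr => k _; congr (_ *: _).
have [l lj e] := node_nested lo hi n ij (ltn_ord k).
by apply: (interp_at_node _ lj); rewrite subst_coord_same -e.
Qed.

Lemma interp_level_ge n i j v : (i <= j)%N -> U n (level j) (U n (level i) v) = U n (level i) v.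
Proof.
move=> ij; apply: interp_polydeg; apply: polydeg_le (polydeg_interp _ _ _).
exact: level_le.
Qed.

(** Nested nodes give [U_i U_j = U_i] for [i <= j], exactness on polynomials gives [U_i U_j = U_j]
    for [j <= i]; hence the differences of consecutive [U] are orthogonal idempotents. *)
Lemma detail_detail n i j v : (0 < i)%N -> (0 < j)%N ->
  detail n i (detail n j v) = if i == j then detail n i v else 0.
Proof.
case: i j => [//|i] [//|j] _ _; rewrite !detailE /= !interpB eqSS.
case: ltngtP => ij.
- by rewrite !interp_level_le ?subrr ?subr0 ?subrr//; lia.
- by rewrite !interp_level_ge ?subrr ?subr0 ?subrr//; lia.
- by rewrite ij (interp_level_ge _ _ (leqnSn j)) !interp_level_le// subrr subr0.
Qed.

Lemma detail_vanish n i j v y k : (i < j)%N -> (k < level i)%N ->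
  y 0 n = node lo hi n (level i) k -> detail n j v y = 0.
Proof.
case: j => // j ij ki yn; rewrite /detail.
have h j' : (i <= j')%N -> U n (level j') v y = v y.
  move=> ij'; have [l lj e] := node_nested lo hi n ij' ki.
  by apply: (interp_at_node _ lj); rewrite e.
by rewrite !h ?subrr//; lia.
Qed.

Lemma interp_mulcoord_detail_lt n i j v : (i < j)%N ->
  U n (level i) (mulcoord n (detail n j v)) = 0.
Proof.
move=> ij; apply/funext => y; apply: interp_eq0 => k ki.
rewrite /mulcoord (detail_vanish _ ij ki) ?scaler0//.
by rewrite subst_coord_same.
Qed.

Lemma interp_mulcoord_detail_gt n i j v : (j < i)%N ->
  U n (level i) (mulcoord n (detail n j v)) = mulcoord n (detail n j v).
Proof.
move=> ij; apply: interp_polydeg.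
apply: (@polydeg_le _ (level j).+1).
  by apply: (leq_trans (level_lt j)); apply: level_le.
apply: polydeg_mulcoord; rewrite detailE -scaleN1r; apply: polydeg_add.
  exact: polydeg_interp.
move=> y; have [s sk e] := polydeg_interp n (level j.-1) v y.
exists [seq (- q.1, q.2) | q <- s].
  apply/allP => _ /mapP[q /(allP sk) qk ->] /=; rewrite size_polyN.
  by apply: (leq_trans qk); apply: level_le; exact: leq_pred.
move=> t; rewrite big_map fctE e scaler_sumr; apply: eq_bigr => q _.
by rewrite hornerN scaleN1r scaleNr.
Qed.

(** Multiplication by the coordinate keeps the zeros of the detail [j] at the nodes of lower levels,
    which excludes [i < j]. It raises the degree by one, which level [j + 1] still reproduces, and
    this excludes [i > j + 1]. *)
Lemma detail_mulcoord_detail n i j v : (0 < i)%N -> i != j -> i != j.+1 ->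
  detail n i (mulcoord n (detail n j v)) = 0.
Proof.
case: i => // i _ ij ij1; rewrite detailE/=; have [ji|ji] := ltnP j i.
  by rewrite !interp_mulcoord_detail_gt ?subrr//; lia.
by rewrite !interp_mulcoord_detail_lt ?subrr//; lia.
Qed.

(** The sum telescopes to [U_(j+1) - U_(j-1)]; the first operator reproduces the product and the
    second annihilates it. *)
Lemma detail_mulcoord_detail_sum n j v : (0 < j)%N ->
  detail n j (mulcoord n (detail n j v)) + detail n j.+1 (mulcoord n (detail n j v)) =
  mulcoord n (detail n j v).
Proof.
case: j => // j _; rewrite ![detail n _ (mulcoord n _)]detailE/=.
rewrite addrC addrA subrK (interp_mulcoord_detail_gt _ _ (ltnSn _)).
by rewrite interp_mulcoord_detail_lt ?subr0.
Qed.

End InterpOperators.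

(** * Tensor-product details *)

Definition incr N (i : mindex N) (n : 'I_N) : mindex N := [ffun k => (i k + (k == n))%N].

Lemma decr_incr N (i : mindex N) n : decr (incr i n) n = i.
Proof. by apply/ffunP => k; rewrite !ffunE addnK. Qed.

Lemma incr_decr N (i : mindex N) (n : 'I_N) : (0 < i n)%N -> incr (decr i n) n = i.
Proof.
by move=> i0; apply/ffunP => k; rewrite !ffunE; case: eqP => [->|]; rewrite ?subn0 ?addn0 ?subnK.
Qed.

Lemma big_two (V : zmodType) (T : eqType) (r : seq T) (x y : T) (F : T -> V) :
  uniq r -> x \in r -> y \in r -> x != y ->
  (forall z, z \in r -> z != x -> z != y -> F z = 0) -> \sum_(z <- r) F z = F x + F y.
Proof.
move=> ur xr yr xy F0; rewrite (bigD1_seq x)//= -big_filter (bigD1_seq y)/= ?filter_uniq//.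
  rewrite big_seq_cond big1 ?addr0// => z /andP[].
  by rewrite mem_filter => /andP[zx zr] zy; exact: F0.
by rewrite mem_filter eq_sym xy.
Qed.

Section DeltaTheory.
Context (R : realType) (N : nat) (lo hi : 'I_N -> R) (X : lmodType R).
Hypothesis lohi : forall n, lo n < hi n.
Implicit Types (n m k : 'I_N) (v w : 'rV[R]_N -> X) (y : 'rV[R]_N).
Implicit Types (i j : mindex N) (s t : seq (mindex N)).

Local Notation U := (interp lo hi).
Local Notation Delta := (Delta lo hi).

(** [Delta] with its fold restricted to a list of coordinates, so that one of them can be
    isolated. *)
Definition details i v (r : seq 'I_N) := foldr (fun n => detail lo hi n (i n)) v r.

Lemma DeltaE i v : Delta i v = details i v (enum 'I_N). Proof. by []. Qed.

Lemma details_lin i r a v w : details i (a *: v + w) r = a *: details i v r + details i w r.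
Proof. by elim: r => //= n r ->; rewrite detail_lin. Qed.

Lemma details0 i r : details i 0 r = 0.
Proof. by have := details_lin i r (-1) 0 0; rewrite scaleN1r oppr0 addr0 scaleN1r addNr. Qed.

Lemma detailsD i r v w : details i (v + w) r = details i v r + details i w r.
Proof. by have := details_lin i r 1 v w; rewrite !scale1r. Qed.

Lemma detailsB i r v w : details i (v - w) r = details i v r - details i w r.
Proof. by rewrite addrC -scaleN1r details_lin scaleN1r addrC. Qed.

Lemma details_comm i n m v : n != m ->
  detail lo hi n (i n) (detail lo hi m (i m) v) = detail lo hi m (i m) (detail lo hi n (i n) v).
Proof. exact: detailC. Qed.

Lemma details_pull i n r v : n \notin r ->
  details i (detail lo hi n (i n) v) r = detail lo hi n (i n) (details i v r).
Proof. by apply: (foldr_comm_pull (@details_comm i)). Qed.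

Lemma details_idem i r v : (forall n, 0 < i n)%N -> uniq r ->
  details i (details i v r) r = details i v r.
Proof.
move=> i0; elim: r => //= n r IH /andP[nr ur].
by rewrite details_pull// IH// detail_detail// eqxx.
Qed.

Lemma details_eq i j v r : {in r, i =1 j} -> details i v r = details j v r.
Proof. by elim: r => //= n r IH h; rewrite IH ?h ?mem_head// => m mr; rewrite h// inE mr orbT. Qed.

Lemma details_mulcoord i n r v : n \notin r ->
  details i (mulcoord n v) r = mulcoord n (details i v r).
Proof.
elim: r => //= m r IH; rewrite inE negb_or => /andP[nm nr].
by rewrite IH// detail_mulcoord_other// eq_sym.
Qed.

Definition rest n i v := details i v (rem n (enum 'I_N)).

Let notin_rem n : n \notin rem n (enum 'I_N).
Proof. by rewrite mem_rem_uniq ?enum_uniq// inE eqxx. Qed.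

Lemma Delta_rest n i v : Delta i v = detail lo hi n (i n) (rest n i v).
Proof.
by rewrite DeltaE; apply: (foldr_comm_rem (@details_comm i)); rewrite ?enum_uniq ?mem_enum.
Qed.

Lemma rest_Delta n i v : Delta i v = rest n i (detail lo hi n (i n) v).
Proof. by rewrite (Delta_rest n) /rest details_pull. Qed.

Lemma DeltaB i v w : Delta i (v - w) = Delta i v - Delta i w.
Proof. exact: detailsB. Qed.

Lemma DeltaD i v w : Delta i (v + w) = Delta i v + Delta i w.
Proof. exact: detailsD. Qed.

Lemma Delta0 i : Delta i (0 : _ -> X) = 0.
Proof. exact: details0. Qed.

Lemma Delta_sum i (J : Type) (r : seq J) (P : pred J) (F : J -> 'rV[R]_N -> X) :
  Delta i (\sum_(j <- r | P j) F j) = \sum_(j <- r | P j) Delta i (F j).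
Proof. by rewrite -(big_morph _ (DeltaD i) (Delta0 i)). Qed.

Lemma Delta_Delta i j v : (forall n, 0 < i n)%N -> (forall n, 0 < j n)%N ->
  Delta i (Delta j v) = if i == j then Delta i v else 0.
Proof.
move=> i0 j0; case: eqP => [<-|/eqP ij].
  by rewrite !DeltaE details_idem// enum_uniq.
have [k ijk] : exists k, i k != j k.
  by apply/existsP; apply: contraNT ij => /existsPn h; apply/eqP/ffunP => k; apply/eqP/negPn.
by rewrite (rest_Delta k) (Delta_rest k j) detail_detail// (negbTE ijk) /rest details0.
Qed.

Lemma mulcoord0 n : mulcoord n (0 : 'rV[R]_N -> X) = 0.
Proof. by apply/funext => y; rewrite /mulcoord scaler0. Qed.

(** Multiplication by coordinate [n] commutes with the operators in the other coordinates. If [i]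
    and [j] differ in one of those, orthogonality there gives zero; otherwise they differ only in
    [n], and by something other than one step up. *)
Lemma Delta_mulcoord_Delta0 i j n v : (forall n, 0 < i n)%N -> (forall n, 0 < j n)%N ->
  i != j -> i != incr j n -> Delta i (mulcoord n (Delta j v)) = 0.
Proof.
move=> i0 j0 ij ij1; have [/existsP[k /andP[kn ijk]]|/existsPn h] :=
  boolP [exists k, (k != n) && (i k != j k)].
  rewrite (rest_Delta k) (Delta_rest k j) detail_mulcoord_other//.
  by rewrite detail_detail// (negbTE ijk) mulcoord0 /rest details0.
have ij' k : k != n -> i k = j k by move=> kn; have := h k; rewrite kn /= negbK => /eqP.
rewrite (rest_Delta n) (Delta_rest n j) detail_mulcoord_detail//.
- by rewrite /rest details0.
- apply: contraNneq ij => e; apply/eqP/ffunP => k.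
  by have [->//|/ij'] := eqVneq k n.
- apply: contraNneq ij1 => e; apply/eqP/ffunP => k; rewrite ffunE.
  by have [->|/ij' ->] := eqVneq k n; rewrite ?e ?addn1 ?addn0.
Qed.

Lemma Delta_mulcoord_Delta_sum j n v : (forall n, 0 < j n)%N ->
  Delta j (mulcoord n (Delta j v)) + Delta (incr j n) (mulcoord n (Delta j v)) =
  mulcoord n (Delta j v).
Proof.
move=> j0; rewrite (rest_Delta n j) (rest_Delta n (incr j n)).
have -> w : rest n (incr j n) w = rest n j w.
  apply: details_eq => k kr; rewrite ffunE.
  by rewrite (_ : (k == n) = false) ?addn0//; apply: contraTF kr => /eqP ->.
rewrite [in LHS](Delta_rest n j) ffunE eqxx addn1 -detailsD.
rewrite detail_mulcoord_detail_sum// details_mulcoord//; congr mulcoord.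
by rewrite details_pull// /rest details_idem ?rem_uniq ?enum_uniq// -Delta_rest.
Qed.

Definition on_grid i y :=
  forall k, exists2 l, (l < level (i k))%N & y 0 k = node lo hi k (level (i k)) l.

(** By nestedness the lower-level interpolants in [Delta i] also sample only on the grid of [i]. *)
Lemma Delta_grid_eq0 i w : (forall y, on_grid i y -> w y = 0) -> Delta i w = 0.
Proof.
move=> w0; apply/funext => y; rewrite DeltaE.
(* Generalized for the induction: coordinates already processed sit at nodes, those still in the
   list are arbitrary. *)
have : forall k, k \notin enum 'I_N ->
    exists2 l, (l < level (i k))%N & y 0 k = node lo hi k (level (i k)) l.
  by move=> k; rewrite mem_enum.
elim: (enum 'I_N) y => /= [|n r IH] y hy; first by rewrite w0// => k; apply: hy.
have h l' l : (l' <= i n)%N -> (l < level l')%N ->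
    details i w r (subst_coord y n (node lo hi n (level l') l)) = 0.
  move=> l'i ll; apply: IH => k kr; rewrite mxE; case: eqP => [->|/eqP kn].
    by have [l2 ? <-] := node_nested lo hi n l'i ll; exists l2.
  by apply: hy; rewrite inE negb_or kn.
rewrite /detail !interp_eq0 ?subrr// => l ll; apply: h => //.
exact: leq_pred.
Qed.

Lemma interps_on_grid i w y r : on_grid i y ->
  foldr (fun n => U n (level (i n))) w r y = w y.
Proof.
move=> iy; elim: r => //= n r <-.
by have [l ll e] := iy n; rewrite (interp_at_node lohi _ ll e).
Qed.

(* The tensor interpolant on the grid of [i] is expanded into details one
   coordinate at a time. *)
Lemma grid_eq0 (I : set (mindex N)) w : down_closed I ->
  (forall i, I i -> forall n, 0 < i n)%N ->
  (forall j, I j -> Delta j w = 0) ->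
  forall i y, I i -> on_grid i y -> w y = 0.
Proof.
move=> Idc I0 Dw i y Ii iy; rewrite -(interps_on_grid w (enum 'I_N) iy).
(* Interpolation in the coordinates of [p] and details in the others; [p] grows from the empty list
   to all coordinates. *)
pose O (p : seq 'I_N) j n : ('rV[R]_N -> X) -> 'rV[R]_N -> X :=
  if n \in p then U n (level (j n)) else detail lo hi n (j n).
have OC p j n m v : n != m -> O p j n (O p j m v) = O p j m (O p j n v).
  move=> nm; rewrite /O; case: ifP => _; case: ifP => _.
  - by rewrite interpC.
  - by rewrite interp_detailC.
  - by rewrite -interp_detailC// eq_sym.
  - by rewrite detailC.
suff h p : uniq p -> forall j, I j -> foldr (O p j) w (enum 'I_N) = 0.
  transitivity (foldr (O (enum 'I_N) i) w (enum 'I_N) y); last by rewrite h ?enum_uniq.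
  by congr (_ y); apply: foldr_eq_in => n nN v; rewrite /O nN.
elim: p => [_ j Ij|k p IH /= /andP[kp up]]; first exact: Dw.
(* Induction on the level [c] in the new coordinate [k]: [U] at level [c + 1] is the detail plus [U]
   at level [c]. The detail part vanishes by [IH], and the rest belongs to [decr j k], which is in
   [I] by downward closedness. *)
suff h c j : I j -> j k = c -> foldr (O (k :: p) j) w (enum 'I_N) = 0.
  by move=> j Ij; apply: (h (j k)).
have kN : k \in enum 'I_N by rewrite mem_enum.
have restE : forall q (j1 j2 : mindex N), (forall n, n != k -> j1 n = j2 n) ->
    foldr (O (k :: q) j1) w (rem k (enum 'I_N)) = foldr (O q j2) w (rem k (enum 'I_N)).
  move=> q j1 j2 jj'; apply: foldr_eq_in => n.
  rewrite mem_rem_uniq ?enum_uniq// inE => /andP[nk _] v.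
  by rewrite /O inE (negbTE nk) /= jj'.
elim: c j => [|c IHc] j Ij jk; first by have := I0 _ Ij k; rewrite jk.
have OE q (j1 : mindex N) : foldr (O q j1) w (enum 'I_N) =
    (if k \in q then U k (level (j1 k)) else detail lo hi k (j1 k))
      (foldr (O q j1) w (rem k (enum 'I_N))).
  exact: (foldr_comm_rem (@OC _ _) _ (enum_uniq 'I_N) kN).
have := IH up _ Ij; rewrite !OE (negbTE kp) mem_head jk detailE /=.
rewrite -(restE _ j j)// => /subr0_eq ->.
case: c IHc jk => [|c] IHc jk; first by rewrite interp0.
have dE n : n != k -> j n = decr j k n by move=> nk; rewrite ffunE (negbTE nk) subn0.
have dk : decr j k k = c.+1 by rewrite ffunE eqxx jk subn1.
have Id : I (decr j k) by apply: Idc => //; rewrite jk.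
have := IHc _ Id dk; rewrite OE mem_head dk => <-.
by rewrite (restE p j (decr j k))// (restE p (decr j k) (decr j k)).
Qed.

Definition Ssum s v : 'rV[R]_N -> X := \sum_(j <- s) Delta j v.

Lemma Delta_Ssum s v i : uniq s -> {in s, forall j n, 0 < j n}%N -> i \in s ->
  Delta i (Ssum s v) = Delta i v.
Proof.
move=> us s0 si; rewrite Delta_sum (bigD1_seq i)//= big_seq_cond big1 ?addr0.
  by rewrite Delta_Delta ?eqxx//; apply: s0.
move=> j /andP[sj ji]; rewrite Delta_Delta; [|exact: s0..].
by rewrite eq_sym (negbTE ji).
Qed.

(** * Details of the flux inside and outside the index set *)

Section Flux.
Context (V0 : 'rV[R]_N -> X) (V : 'I_N -> 'rV[R]_N -> X).

(** With [V0 = a0 grad u] and [V n = an grad u] this is [a grad u], and [flux_on s] is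
    [a grad S_s u]: interpolation in [y] commutes with multiplication by functions of [x]. *)
Definition full_flux := V0 + \sum_n mulcoord n (V n).

Definition flux_on s := Ssum s V0 + \sum_n mulcoord n (Ssum s (V n)).

Lemma mulcoord_sum n (J : Type) (r : seq J) (P : pred J) (F : J -> 'rV[R]_N -> X) :
  mulcoord n (\sum_(j <- r | P j) F j) = \sum_(j <- r | P j) mulcoord n (F j).
Proof.
apply: (big_morph (mulcoord n)); last exact: mulcoord0.
by move=> v w; apply/funext => y; rewrite /mulcoord scalerDr.
Qed.

Lemma flux_onE s :
  flux_on s = \sum_(j <- s) (Delta j V0 + \sum_n mulcoord n (Delta j (V n))).
Proof.
rewrite /flux_on big_split exchange_big; congr (_ + _).
by apply: eq_bigr => n _; rewrite mulcoord_sum.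
Qed.

(** The sparse interpolant agrees with its argument on the grid of every index of a downward-closed
    [s], and [Delta i] sees only the grid of [i]. *)
Lemma Delta_flux_on s i : uniq s -> {in s, forall j n, 0 < j n}%N ->
  down_closed [set` s] -> i \in s -> Delta i (flux_on s) = Delta i full_flux.
Proof.
move=> us s0 sdc si; apply/eqP; rewrite -subr_eq0 -DeltaB; apply/eqP.
apply: Delta_grid_eq0 => y iy.
have h v : Ssum s v y = v y.
  apply/eqP; rewrite -subr_eq0; apply/eqP.
  apply: (@grid_eq0 [set` s] (Ssum s v - v) sdc s0 _ i) => // j sj.
  by rewrite DeltaB Delta_Ssum// subrr.
have sumE (F : 'I_N -> 'rV[R]_N -> X) : (\sum_n F n) y = \sum_n F n y.
  by rewrite fct_sumE.
rewrite /flux_on /full_flux.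
transitivity (Ssum s V0 y + \sum_n mulcoord n (Ssum s (V n)) y -
  (V0 y + \sum_n mulcoord n (V n) y)); 
  first by rewrite -(sumE (fun n => mulcoord n (Ssum s (V n)))) -(sumE (fun n => mulcoord n (V n))).
rewrite h; apply/eqP; rewrite subr_eq0; apply/eqP; congr (_ + _).
by apply: eq_bigr => n _; rewrite /mulcoord h.
Qed.

Lemma incr_neq j n : incr j n != j.
Proof.
by apply/eqP => /ffunP /(_ n); rewrite ffunE eqxx addn1 => /eqP; rewrite eqn_leq ltnn.
Qed.

(** The product of [y_n] with the detail [j] has only the details [j] and [incr j n]. In the
    application [t] is the margin of [s], so both lie in [s ++ t]. *)
Lemma flux_on_sum s t : uniq (s ++ t) -> {in s ++ t, forall j n, 0 < j n}%N ->
  {in s, forall j n, incr j n \in s ++ t} ->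
  flux_on s = \sum_(i <- s ++ t) Delta i (flux_on s).
Proof.
move=> ust st0 sst; rewrite {2}flux_onE.
under [RHS]eq_bigr => i _ do rewrite Delta_sum.
rewrite [RHS]exchange_big /= flux_onE; apply: eq_big_seq => j sj.
have stj : j \in s ++ t by rewrite mem_cat sj.
under [RHS]eq_bigr => i _ do rewrite DeltaD Delta_sum.
rewrite big_split; congr (_ + _).
  rewrite (bigD1_seq j)//= big_seq_cond big1 ?addr0.
    by rewrite Delta_Delta ?eqxx//; apply: st0.
  by move=> i /andP[sti ij]; rewrite Delta_Delta ?(negbTE ij)//; apply: st0.
rewrite exchange_big; apply: eq_bigr => n _ /=.
rewrite (@big_two _ _ _ j (incr j n))//; first by rewrite Delta_mulcoord_Delta_sum//; exact: st0.
- exact: sst.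
- by rewrite eq_sym incr_neq.
by move=> i sti ij iij; rewrite Delta_mulcoord_Delta0//; exact: st0.
Qed.

Lemma Delta_flux_off s i : (forall n, 0 < i n)%N -> {in s, forall j n, 0 < j n}%N -> i \notin s ->
  Delta i (flux_on s) =
  \sum_n \sum_(j <- s | incr j n == i) Delta i (mulcoord n (Delta j (V n))).
Proof.
move=> i0 s0 si; rewrite flux_onE Delta_sum.
under [RHS]eq_bigr => n _ do rewrite big_mkcond.
rewrite [RHS]exchange_big.
rewrite big_seq [RHS]big_seq; apply: eq_bigr => j sj.
have ij : i != j by apply: contraNneq si => ->.
rewrite DeltaD Delta_Delta// ?(negbTE ij) ?add0r; last exact: s0.
rewrite Delta_sum; apply: eq_bigr => n _ /=.
case: ifPn => // iij; rewrite Delta_mulcoord_Delta0//; first exact: s0.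
by rewrite eq_sym.
Qed.

End Flux.
End DeltaTheory.

(** * Lebesgue constants *)

Section CosineSums.
Context (R : realType).
Implicit Types (x p : R).

(** Interior frequencies count twice and the two end ones once, the weights of discrete cosine
    orthogonality. *)
Definition trapezoid_cos (K : nat) x : R :=
  \sum_(k < K) (cos (k%:R * x) + cos (k.+1%:R * x)).

(** The closed form [cot (x / 2) * sin (K x)] of twice the modified Dirichlet kernel at [x = 2 p],
    cleared of denominators. *)
Lemma sin_trapezoid_cos K p :
  sin p * trapezoid_cos K (2 * p) = cos p * sin (K%:R * (2 * p)).
Proof.
rewrite /trapezoid_cos; elim: K => [|K IH]; first by rewrite big_ord0 mul0r sin0 !mulr0.
rewrite big_ord_recr mulrDr IH /= (_ : K.+1%:R * (2 * p) = K%:R * (2 * p) + (p + p)); last first.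
  by rewrite -[K.+1%:R]natr1 mulrDl mul1r -mulr2n [2 * p]mulr_natl.
rewrite !cosD !sinD !cosD.
have := cos2Dsin2 p; set c := cos p; set s := sin p; set A := cos _; set B := sin _ => cs.
apply: subr0_eq; transitivity ((c * B + s * A) * (1 - (c ^+ 2 + s ^+ 2))); first by ring.
by rewrite cs subrr mulr0.
Qed.

Lemma sin_natpi l : sin (pi * l%:R : R) = 0.
Proof.
elim: l => [|l IH]; first by rewrite mulr0 sin0.
by rewrite -[l.+1%:R]natr1 mulrDr mulr1 sinDpi IH oppr0.
Qed.

Lemma trapezoid_cos_eq0 K l : (0 < l < K.*2)%N -> trapezoid_cos K (pi * l%:R / K%:R) = 0.
Proof.
move=> /andP[l0 lK]; have K0 : K%:R != 0 :> R by rewrite pnatr_eq0; lia.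
pose p : R := pi * l%:R / (2 * K%:R).
have -> : pi * l%:R / K%:R = 2 * p by rewrite /p; field.
have : sin p != 0.
  rewrite gt_eqF// sin_gt0_pi// /p divr_gt0 ?mulr_gt0 ?pi_gt0 ?ltr0n//=; last lia.
  rewrite ltr_pdivrMr ?mulr_gt0 ?ltr0n//; last lia.
  by rewrite ltr_pM2l ?pi_gt0// -natrM ltr_nat; lia.
move=> /mulfI; apply; rewrite sin_trapezoid_cos mulr0.
have -> : K%:R * (2 * p) = pi * l%:R by rewrite /p; field.
by rewrite sin_natpi mulr0.
Qed.

Lemma trapezoid_cosN K x : trapezoid_cos K (- x) = trapezoid_cos K x.
Proof. by apply: eq_bigr => k _; rewrite !mulrN !cosN. Qed.

Lemma trapezoid_cos0 K : trapezoid_cos K 0 = 2 * K%:R.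
Proof.
rewrite /trapezoid_cos (eq_bigr (fun=> 2)); last by move=> k _; rewrite !mulr0 cos0.
by rewrite sumr_const card_ord mulr_natr.
Qed.

Lemma trapezoid_cos2pi K : trapezoid_cos K (pi *+ 2) = 2 * K%:R.
Proof.
have h (k : nat) : cos (k%:R * (pi *+ 2)) = 1 :> R.
  by elim: k => [|k IH]; rewrite ?mul0r ?cos0// -[k.+1%:R]natr1 mulrDl mul1r cosD2pi.
by rewrite -(trapezoid_cos0 K); apply: eq_bigr => k _; rewrite !mulr0 cos0 !h.
Qed.

(* [chebyshev L k] evaluates to [cos (k * t)] wherever [L] evaluates to [cos t]. *)
Fixpoint chebyshev (L : {poly R}) k : {poly R} * {poly R} :=
  if k is k'.+1 then let: (p, q) := chebyshev L k' in (q, 2%:P * L * q - p) else (1, L).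

Lemma horner_chebyshev (L : {poly R}) s t k : L.[s] = cos t ->
  ((chebyshev L k).1.[s] = cos (k%:R * t)) * ((chebyshev L k).2.[s] = cos (k.+1%:R * t)).
Proof.
move=> Ls; elim: k => [|k]; first by rewrite /= hornerC mul0r cos0 mul1r.
rewrite /=; case: (chebyshev L k) => p q /= [ep eq]; rewrite eq; split=> //.
rewrite !hornerE ep eq Ls.
have -> : k.+2%:R * t = k.+1%:R * t + t by rewrite -[k.+2%:R]natr1; ring.
have -> : k%:R * t = k.+1%:R * t - t by rewrite -[k.+1%:R]natr1; ring.
by rewrite cosB cosD; ring.
Qed.

Lemma size_chebyshev (L : {poly R}) k : (size L <= 2)%N ->
  ((size (chebyshev L k).1 <= k.+1) && (size (chebyshev L k).2 <= k.+2))%N.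
Proof.
move=> L2; elim: k => [|k]; first by rewrite /= size_poly1.
rewrite /=; case: (chebyshev L k) => p q /= /andP[sp sq]; rewrite sq /=.
rewrite (leq_trans (size_polyD _ _))// geq_max size_polyN (leq_trans sp) ?andbT; last by lia.
rewrite (leq_trans (size_polyMleq _ _))//.
have : (size (2%:P * L)%R <= 2)%N.
  by rewrite mul_polyC (leq_trans (size_scale_leq _ _)).
by move=> sz; rewrite -subn1 leq_subLR; exact: (leq_add sz sq).
Qed.

End CosineSums.

Section LebesgueConstant.
Context (R : realType) (N : nat) (lo hi : 'I_N -> R).
Hypothesis lohi : forall n, lo n < hi n.

(* By discrete orthogonality of cosines, [F] vanishes at all nodes but the [j]-th. *)
Lemma lagrange_cosE n K (j : 'I_K.+2) (t : R) (q : R) :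
  t = (lo n + hi n) / 2 - (hi n - lo n) / 2 * cos q ->
  let F x := \sum_(k < K.+1) (cos (k%:R * (pi * j%:R / K.+1%:R)) * cos (k%:R * x) +
    cos (k.+1%:R * (pi * j%:R / K.+1%:R)) * cos (k.+1%:R * x)) in
  exists2 c, K.+1%:R <= c & lagrange lo hi n j t * c = F q.
Proof.
move=> tq F; pose th (i : nat) : R := pi * i%:R / K.+1%:R.
have h0 : (hi n - lo n) / 2 != 0 by rewrite gt_eqF// divr_gt0// subr_gt0.
pose L : {poly R} := ((hi n - lo n) / 2)^-1 *: (((lo n + hi n) / 2)%:P - 'X).
have L2 : (size L <= 2)%N.
  by rewrite (leq_trans (size_scale_leq _ _))// -opprB size_polyN size_XsubC.
have Lcos x : L.[(lo n + hi n) / 2 - (hi n - lo n) / 2 * cos x] = cos x.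
  rewrite /L hornerZ !hornerE opprB addrCA subrr addr0; exact: mulKf.
have Fe x y : cos x * cos y = (cos (x - y) + cos (x + y)) / 2.
  by rewrite cosB cosD; field.
have FE (i : nat) : F (th i) = (trapezoid_cos K.+1 (th j - th i) +
    trapezoid_cos K.+1 (th j + th i)) / 2.
  rewrite /trapezoid_cos -big_split mulr_suml; apply: eq_bigr => k _ /=.
  by rewrite !Fe -!mulrBr -!mulrDr; field.
have thD (i : nat) : th j + th i = pi * (j + i)%:R / K.+1%:R by rewrite /th natrD; field.
have thB (i l : nat) : (i <= l)%N -> th l - th i = pi * (l - i)%:R / K.+1%:R.
  by move=> il; rewrite /th natrB//; field.
(* The value at the own node is the mean of the kernel at 0 and at twice the angle: [K + 1] at
   interior nodes and twice that at the end nodes. *)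
have Fj : K.+1%:R <= F (th j).
  rewrite FE subrr trapezoid_cos0 thD.
  suff : 0 <= trapezoid_cos K.+1 (pi * (j + j)%:R / K.+1%:R : R) by lra.
  have [j0|j0] := posnP j; first by rewrite j0 mulr0 mul0r trapezoid_cos0.
  have [jK|jK] := ltnP j K.+1; first by rewrite trapezoid_cos_eq0//; lia.
  have -> : (j + j = 2 * K.+1)%N by have := ltn_ord j; lia.
  rewrite natrM mulrA mulfK ?pnatr_eq0// mulr_natr trapezoid_cos2pi.
  by rewrite mulr_ge0.
have F0 (i : 'I_K.+2) : i != j -> F (th i) = 0.
  move=> ij; rewrite FE thD trapezoid_cos_eq0; last first.
    by have := ltn_ord i; have := ltn_ord j; have : i != j :> nat by []; lia.
  suff -> : trapezoid_cos K.+1 (th j - th i) = 0 by rewrite addr0 mul0r.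
  have [ji|ji|e] := ltngtP (i : nat) j; last by rewrite (val_inj e) eqxx in ij.
    by rewrite (thB _ _ (ltnW ji)) trapezoid_cos_eq0//; have := ltn_ord j; lia.
  rewrite -trapezoid_cosN opprB (thB _ _ (ltnW ji)) trapezoid_cos_eq0//.
  by have := ltn_ord i; lia.
exists (F (th j)) => //.
(* [F] as a polynomial in [t]; its degree is at most [K + 1], so the [K + 2] nodes determine it. *)
pose p := \sum_(k < K.+1) (cos (k%:R * th j) *: (chebyshev L k).1 +
  cos (k.+1%:R * th j) *: (chebyshev L k).2).
have pE x : p.[(lo n + hi n) / 2 - (hi n - lo n) / 2 * cos x] = F x.
  rewrite horner_sum; apply: eq_bigr => k _.
  by rewrite hornerD !hornerZ !(horner_chebyshev _ (Lcos x)).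
have sp : (size p <= K.+2)%N.
  apply: (leq_trans (size_sum _ _ _)); apply/bigmax_leqP => k _.
  have /andP[s1 s2] := size_chebyshev k L2.
  rewrite (leq_trans (size_polyD _ _))// geq_max.
  rewrite !(leq_trans (size_scale_leq _ _))//; have := ltn_ord k.
    by move=> ?; apply: (leq_trans s2).
  by move=> ?; apply: (leq_trans s1); rewrite ltnS ltnW.
have nodeE (i : 'I_K.+2) : node lo hi n K.+2 i =
    (lo n + hi n) / 2 - (hi n - lo n) / 2 * cos (th i).
  by rewrite /node /cc_node /= mulrN.
rewrite -[RHS]pE -tq -(sum_lagrange lohi n t sp) (bigD1 j)//= nodeE pE big1 ?addr0// => i ij.
by rewrite nodeE pE F0 ?mulr0.
Qed.

(** [F] has [K + 1] terms of modulus at most 2, and its normalizing constant is at least [K + 1].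
    Summed over [j], this bounds the Lebesgue constant linearly in the number of nodes. *)
Lemma lagrange_bound n M (j : 'I_M) t : lo n <= t <= hi n -> `|lagrange lo hi n j t| <= 2.
Proof.
move=> /andP[lt th]; case: M j => [[]//|[|K]] j.
  rewrite /lagrange big1 ?normr1 ?ler1n// => k; by rewrite (ord1 k) (ord1 j) eqxx.
have ln := lohi n.
have h0 : 0 < hi n - lo n by rewrite subr_gt0.
pose x := (lo n + hi n - 2 * t) / (hi n - lo n).
have x1 : -1 <= x <= 1.
  by rewrite /x ler_pdivlMr// ler_pdivrMr//; apply/andP; split; lra.
have te : t = (lo n + hi n) / 2 - (hi n - lo n) / 2 * cos (acos x).
  by rewrite acosK// /x; field; rewrite gt_eqF.
have [c Kc e] := lagrange_cosE j te.
have K0 : 0 < K.+1%:R :> R by rewrite ltr0n.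
have c0 : 0 < c by apply: lt_le_trans Kc.
rewrite -(ler_pM2r c0) -[X in _ * X](gtr0_norm c0) -normrM e.
apply: le_trans (_ : 2 * K.+1%:R <= _); last by rewrite ler_pM2l.
apply: (le_trans (ler_norm_sum _ _ _)).
have -> : 2 * K.+1%:R = \sum_(k < K.+1) 2 :> R by rewrite sumr_const card_ord mulr_natr.
apply: ler_sum => k _; apply: (le_trans (ler_normD _ _)); rewrite !normrM.
have cos1 (y : R) : `|cos y| <= 1 by rewrite ler_norml cos_geN1 cos_le1.
by rewrite -[2]/(1 + 1) lerD// mulr_ile1 ?normr_ge0 ?cos1.
Qed.

End LebesgueConstant.

(** * Details as combinations of samples *)

Section Sampling.
Context (R : realType) (N : nat) (lo hi : 'I_N -> R).
Hypothesis lohi : forall n, lo n < hi n.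

Definition eval (X : lmodType R) (r : seq (R * 'rV[R]_N)) (v : 'rV[R]_N -> X) : X :=
  \sum_(q <- r) q.1 *: v q.2.

Definition weight (r : seq (R * 'rV[R]_N)) : R := \sum_(q <- r) `|q.1|.

(** The list [r] depends on [y] but on neither [X] nor [v]: the same points and weights serve for
    [u], the fluxes, the iterates and real-valued functions, and linear maps pass through. The
    points stay in [Gam], where alone [u] is controlled. *)
Definition samples (O : forall X : lmodType R, ('rV[R]_N -> X) -> 'rV[R]_N -> X) B :=
  forall y, Gam lo hi y -> exists r,
    [/\ forall q, q \in r -> Gam lo hi q.2, weight r <= B &
        forall X v, O X v y = eval r v].

Lemma samples_le O B B' : B <= B' -> samples O B -> samples O B'.
Proof.
move=> BB' h y /h[r [rG rB rE]]; exists r; split=> //; exact: le_trans BB'.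
Qed.

Lemma samples_interp n M : samples (fun X => interp lo hi n M (X:=X)) (M%:R * 2).
Proof.
move=> y Gy; exists [seq (lagrange lo hi n j (y 0 n), subst_coord y n (node lo hi n M j)) |
  j <- enum 'I_M]; split.
- by move=> _ /mapP[j _ ->] /=; apply: Gam_subst_coord => //; apply: node_bound.
- rewrite /weight big_map big_enum /= mulr_natl -[in leRHS](card_ord M) -sumr_const.
  by apply: ler_sum => j _; apply: lagrange_bound.
- by move=> X v; rewrite /eval big_map big_enum.
Qed.

(** Two interpolants, each with at most [2 ^ i] nodes and Lagrange polynomials bounded by 2, account
    for the factor 4. *)
Lemma samples_detail n i : samples (fun X => detail lo hi n i (X:=X)) (4 * 2 ^+ i).
Proof.
apply: (@samples_le _ ((level i)%:R * 2 + (level i.-1)%:R * 2)).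
  have h j : (j <= i)%N -> (level j)%:R <= 2 ^+ i :> R.
    by move=> ji; rewrite -natrX ler_nat (leq_trans (level_le ji))// level_le_exp.
  by have := h i (leqnn _); have := h i.-1 (leq_pred _); lra.
move=> y Gy; have [r [rG rB rE]] := samples_interp n (level i) Gy.
have [s [sG sB sE]] := samples_interp n (level i.-1) Gy.
exists (r ++ [seq (- q.1, q.2) | q <- s]); split.
- by move=> q; rewrite mem_cat => /orP[/rG//|/mapP[q' /sG ? ->]].
- rewrite /weight big_cat big_map lerD//=.
  by under eq_bigr do rewrite normrN.
- move=> X v; rewrite /detail rE sE /eval big_cat big_map -sumrN; congr (_ + _).
  by apply: eq_bigr => q _; rewrite scaleNr.
Qed.

Lemma samples_comp (O O' : forall X : lmodType R, ('rV[R]_N -> X) -> 'rV[R]_N -> X) B B' :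
  0 <= B' -> samples O B -> samples O' B' -> samples (fun X v => O X (O' X v)) (B * B').
Proof.
move=> B'0 h h' y /h[r [rG rB rE]].
have [s [sG sB sE]] : exists s, [/\ forall q, q \in s -> Gam lo hi q.2,
    weight s <= weight r * B' & forall X v, eval r (O' X v) = eval s v].
  elim: r rG {rB rE} => [_|[c p] r IH rG].
    by exists [::]; split=> //; rewrite /weight ?big_nil ?mul0r// => X v; rewrite /eval !big_nil.
  have [q qr|s [sG sB sE]] := IH; first by apply: rG; rewrite inE qr orbT.
  have [t [tG tB tE]] := h' p (rG _ (mem_head _ _)).
  exists ([seq (c * q.1, q.2) | q <- t] ++ s); split.
  - by move=> q; rewrite mem_cat => /orP[/mapP[q' /tG ? ->]|/sG].
  - rewrite /weight big_cat big_map big_cons mulrDl lerD//=.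
    by under eq_bigr do rewrite normrM; rewrite -mulr_sumr ler_wpM2l.
  - move=> X v; have := sE X v; rewrite /eval big_cons big_cat big_map /= => ->.
    by rewrite tE scaler_sumr; congr (_ + _); apply: eq_bigr => q _; rewrite scalerA.
exists s; split=> //; last by move=> X v; rewrite rE sE.
by apply: (le_trans sB); rewrite ler_wpM2r.
Qed.

Lemma samples_Delta i : samples (fun X => Delta lo hi i (X:=X)) (\prod_n (4 * 2 ^+ i n)).
Proof.
have -> : \prod_n (4 * 2 ^+ i n) = \prod_(n <- enum 'I_N) (4 * 2 ^+ i n) :> R.
  by rewrite big_enum.
rewrite /Delta; elim: (enum 'I_N) => [|n r IH].
  move=> y Gy; exists [:: (1, y)]; split.
  - by move=> q; rewrite inE => /eqP ->.
  - by rewrite /weight big_seq1 big_nil normr1.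
  - by move=> X v; rewrite /eval big_seq1 scale1r.
rewrite big_cons; apply: (samples_comp (O := fun X => detail lo hi n (i n) (X:=X))) IH.
  by apply: prodr_ge0 => k _; rewrite mulr_ge0// exprn_ge0.
exact: samples_detail.
Qed.

Lemma raddf_eval (X Y : lmodType R) (f : {linear X -> Y}) r v :
  f (eval r v) = eval r (f \o v).
Proof. by rewrite /eval linear_sum; apply: eq_bigr => q _; rewrite linearZ. Qed.

End Sampling.

(** * Richardson iteration *)

Lemma discriminant_le0 (R : realType) (a b c : R) : 0 <= c ->
  (forall t, 0 <= a + 2 * b * t + c * t ^+ 2) -> b ^+ 2 <= a * c.
Proof.
rewrite le_eqVlt => /predU1P[<-|c0] h.
  rewrite mulr0; have [->|b0] := eqVneq b 0; first by rewrite expr0n.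
  (* With [c = 0] and [b] nonzero, the affine function of [t] takes the value -1 here. *)
  have := h (- (a + 1) / (2 * b)).
  have -> : 2 * b * (- (a + 1) / (2 * b)) = - (a + 1) by field.
  lra.
have := h (- b / c).
have -> : a + 2 * b * (- b / c) + c * (- b / c) ^+ 2 = (a * c - b ^+ 2) / c.
  by field; rewrite gt_eqF.
by rewrite pmulr_lge0 ?invr_gt0// subr_ge0.
Qed.

Section Richardson.
Context (R : realType) (m : nat).
Implicit Types (x z : 'rV[R]_m) (M G : 'M[R]_m).

Definition form M x z : R := (x *m M *m z^T) 0 0.

Lemma formDl M x x' z : form M (x + x') z = form M x z + form M x' z.
Proof. by rewrite /form !mulmxDl mxE. Qed.

Lemma formZl M a x z : form M (a *: x) z = a * form M x z.
Proof. by rewrite /form -!scalemxAl mxE. Qed.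

Lemma formDr M x z z' : form M x (z + z') = form M x z + form M x z'.
Proof. by rewrite /form linearD mulmxDr mxE. Qed.

Lemma formZr M a x z : form M x (a *: z) = a * form M x z.
Proof. by rewrite /form linearZ -scalemxAr mxE. Qed.

Lemma formC M x z : M^T = M -> form M x z = form M z x.
Proof.
move=> sM; rewrite /form (_ : x *m M *m z^T = (z *m M *m x^T)^T) 1?mxE//.
by rewrite !trmx_mul trmxK sM mulmxA.
Qed.

Lemma form_CS M x z : M^T = M -> (forall x, 0 <= form M x x) ->
  form M x z ^+ 2 <= form M x x * form M z z.
Proof.
move=> sM M0; apply: discriminant_le0 => // t.
have -> : form M x x + 2 * form M x z * t + form M z z * t ^+ 2 =
    form M (x + t *: z) (x + t *: z); last exact: M0.
by rewrite !(formDl, formDr, formZl, formZr) (formC z x)//; ring.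
Qed.

Lemma form_delta M k x : form M (delta_mx 0 k) x = (M *m x^T) k 0.
Proof. by rewrite /form -rowE -row_mul mxE. Qed.

Section Step.
Context (G A : 'M[R]_m) (amin amax : R).
Hypotheses (sG : G^T = G) (G0 : forall x, 0 <= form G x x) (sA : A^T = A).
Hypotheses (amin0 : 0 < amin) (aminmax : amin <= amax).
Hypothesis (GA : forall x, amin * form G x x <= form A x x <= amax * form G x x).

Let A0 x : 0 <= form A x x.
Proof. by have /andP[+ _] := GA x; apply: le_trans; rewrite mulr_ge0// ltW. Qed.

Let amax0 : 0 < amax. Proof. exact: lt_le_trans aminmax. Qed.

(** [G] may be singular, since sampled solutions may be linearly dependent. A vector in its kernel
    has zero energy for [A] by [GA], hence is in the kernel of [A] by Cauchy-Schwarz. This is what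
    makes [pinvmx G] an exact solver for right-hand sides of the form [E *m A]. *)
Lemma energy_submx : (A <= G)%MS.
Proof.
rewrite submxE; apply/eqP/matrixP => k l; rewrite [RHS]mxE.
pose z := (col l (cokermx G))^T.
have Gz : form G z z = 0.
  by rewrite /form -mulmxA trmxK colE (mulmxA G) mulmx_coker mul0mx mulmx0 mxE.
have Az : form A z z = 0.
  by apply/eqP; rewrite eq_le A0 andbT; have /andP[_] := GA z; rewrite Gz mulr0.
have := form_CS (delta_mx 0 k) z sA A0; rewrite Az mulr0 form_delta trmxK colE mulmxA -colE mxE.
by move=> h; apply/eqP; rewrite -sqrf_eq0 eq_le h sqr_ge0.
Qed.

(* The step [amin / amax ^ 2] would minimize this bound; half of it keeps the
   contraction factor positive when [amin = amax]. *)
Lemma richardson_step E : let E' := E - (amin / (2 * amax ^+ 2)) *: (E *m A *m pinvmx G) in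
  form G E' E' <= (1 - 3 / 4 * (amin / amax) ^+ 2) * form G E E.
Proof.
set th := amin / _; set T := E *m A *m pinvmx G => /=.
(* [T] is the Riesz representative, with respect to [G], of the functional [form A E]. *)
have TG : T *m G = E *m A by rewrite /T mulmxKpV// (submx_trans (submxMl _ _) energy_submx).
have fT z : form G T z = form A E z by rewrite /form TG.
(* Cauchy-Schwarz for [A] bounds the square of [form G T T = form A E T]; one factor [form G T T]
   then cancels. *)
have T_le : form G T T <= amax ^+ 2 * form G E E.
  have [T0|T0] := leP (form G T T) 0; first by rewrite (le_trans T0)// mulr_ge0// exprn_ge0// ltW.
  have := form_CS E T sA A0; rewrite -fT => h.
  have /andP[_ hE] := GA E; have /andP[_ hT] := GA T.
  rewrite -(ler_pM2r T0) -expr2 (le_trans h)//.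
  have -> : amax ^+ 2 * form G E E * form G T T = (amax * form G E E) * (amax * form G T T) by ring.
  by apply: ler_pM.
have -> : form G (E - th *: T) (E - th *: T) =
    form G E E - 2 * th * form A E E + th ^+ 2 * form G T T.
  by rewrite -scaleNr !(formDl, formDr, formZl, formZr) (formC E T)// fT; ring.
have /andP[hE _] := GA E.
have th0 : 0 < th by rewrite /th divr_gt0// mulr_gt0// exprn_gt0.
have h1 : 2 * th * (amin * form G E E) <= 2 * th * form A E E.
  by rewrite ler_pM2l// mulr_gt0.
have h2 : th ^+ 2 * form G T T <= th ^+ 2 * (amax ^+ 2 * form G E E).
  by rewrite ler_pM2l// exprn_gt0.
have -> : (1 - 3 / 4 * (amin / amax) ^+ 2) * form G E E = form G E E -
   2 * th * (amin * form G E E) + th ^+ 2 * (amax ^+ 2 * form G E E).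
  by rewrite /th; field; rewrite gt_eqF.
lra.
Qed.

End Step.

Section Iteration.
Context (N : nat) (Gm : set 'rV[R]_N) (G A0 : 'M[R]_m) (An : 'I_N -> 'M[R]_m) (F : 'rV[R]_m)
  (p : 'I_m -> 'rV[R]_N) (amin amax C : R).
Let A (y : 'rV[R]_N) := A0 + \sum_n y 0 n *: An n.
Hypotheses (sG : G^T = G) (G0 : forall x, 0 <= form G x x).
Hypotheses (sA : forall y, Gm y -> (A y)^T = A y).
Hypotheses (amin0 : 0 < amin) (aminmax : amin <= amax).
Hypothesis (GA : forall y x, Gm y -> amin * form G x x <= form (A y) x x <= amax * form G x x).
Hypotheses (Gmp : forall k, Gm (p k)) (FA : forall k, row k (A (p k)) = F).
Hypothesis (C0 : forall k, form G (delta_mx 0 k) (delta_mx 0 k) <= C).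

(** By [FA] the vector [delta_mx 0 k] is a fixed point of the iteration at [p k], so
    [richardson_step] contracts the error there. The iterate is one formula for all [y], and since
    [A y] is affine in [y], each step raises the degree in a coordinate by at most one. *)
Lemma richardson n K : exists2 v : 'rV[R]_N -> 'rV[R]_m, polydeg n K v &
  forall k, form G (delta_mx 0 k - v (p k)) (delta_mx 0 k - v (p k)) <=
    (1 - 3 / 4 * (amin / amax) ^+ 2) ^+ K * C.
Proof.
elim: K => [|K [v vK vE]].
  exists 0 => [y|k]; first by exists [::] => // t; rewrite big_nil.
  by rewrite [0 _](_ : _ = 0)// subr0 expr0 mul1r.
have lin (B : 'M[R]_m) k (w : 'rV[R]_N -> 'rV[R]_m) : polydeg n k w ->
    polydeg n k (fun y => w y *m B).
  move=> h y; have [s sk e] := h y; exists [seq (q.1, q.2 *m B) | q <- s].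
    by apply/allP => _ /mapP[q /(allP sk) qk ->].
  move=> t; rewrite e mulmx_suml big_map; apply: eq_bigr => q _ /=.
  by rewrite scalemxAl.
pose th := amin / (2 * amax ^+ 2).
exists (fun y : 'rV[R]_N => v y + th *: ((F - v y *m A y) *m pinvmx G)).
  apply: polydeg_add; first exact: polydeg_le vK.
  have -> : (fun y : 'rV[R]_N => th *: ((F - v y *m A y) *m pinvmx G)) =
      (fun y : 'rV[R]_N => (F + - (v y *m A0) + - \sum_n y 0 n *: (v y *m An n)) *m
        (th *: pinvmx G)).
    apply/funext => y; rewrite -scalemxAr; congr (_ *: (_ *m _)).
    rewrite mulmxDr opprD addrA mulmx_sumr; congr (_ - _).
    by apply: eq_bigr => k _; rewrite scalemxAr.
  refine (lin (th *: pinvmx G) K.+1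
    (fun y : 'rV[R]_N => F + - (v y *m A0) + - \sum_n y 0 n *: (v y *m An n)) _).
  have N1 k (w : 'rV[R]_N -> 'rV[R]_m) : polydeg n k w -> polydeg n k (fun y => - w y).
    by move=> /(lin (- 1%:M)); congr polydeg; apply/funext => y; rewrite mulmxN mulmx1.
  apply: (polydeg_add (v := fun y => F + - (v y *m A0))
    (w := fun y : 'rV[R]_N => - \sum_n y 0 n *: (v y *m An n))).
    apply: (polydeg_add (v := fun=> F) (w := fun y => - (v y *m A0))).
      exact: polydeg_cst.
    by apply: N1; apply: lin; apply: polydeg_le vK.
  apply: N1.
  have -> : (fun y : 'rV[R]_N => \sum_n y 0 n *: (v y *m An n)) =
      \sum_k mulcoord k (fun y => v y *m An k) by rewrite fct_sumE.
  apply: polydeg_sum => k; have [->|kn] := eqVneq k n.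
    by apply: polydeg_mulcoord; apply: lin.
  by apply: polydeg_mulcoord_other => //; apply: lin; apply: polydeg_le vK.
move=> k; rewrite -(FA k) rowE -mulmxBl opprD addrA.
apply: (le_trans (richardson_step (A := A (p k)) sG G0 (sA _) amin0 aminmax _ _)) => //.
  by move=> x; apply: GA.
have q0 : 0 <= 1 - 3 / 4 * (amin / amax) ^+ 2.
  have amax0 : 0 < amax by apply: lt_le_trans aminmax.
  have : (amin / amax) ^+ 2 <= 1.
    by rewrite expr_le1// ?ler_pdivrMr ?mul1r// divr_ge0// ltW.
  lra.
set q := 1 - _ in q0 vE *; by rewrite exprS -mulrA; apply: ler_wpM2l.
Qed.

End Iteration.
End Richardson.

(** * Decay of the details and reliability *)

(** Used with [a = j k0] and [b] telling whether [k0] is the coordinate in which [j] was raised. *)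
Lemma addb_sub2_le (a : nat) (b : bool) : (a + b - 2 <= a.-1)%N.
Proof. by case: b; lia. Qed.

Lemma linear_exp_bounded (R : realType) (r : R) : 0 < r < 1 ->
  exists2 C, 0 <= C & forall L, L.+1%:R * r ^+ L <= C.
Proof.
(* Bernoulli's inequality with [1 + e <= r^-1]; the cap [e <= 1] ensures [(L + 1) e <= 1 + L e]. *)
move=> /andP[r0 r1]; pose e := Num.min 1 (r^-1 - 1).
have e0 : 0 < e by rewrite lt_min ltr01 subr_gt0 invf_gt1.
exists e^-1; first by rewrite invr_ge0 ltW.
move=> L; rewrite -[leRHS]mul1r ler_pdivlMr// mulrAC -ler_pdivlMr ?exprn_gt0// mul1r -exprVn.
have e1 : e <= 1 by rewrite ge_min lexx.
have h : 1 + e <= r^-1 by rewrite -lerBrDl ge_min lexx orbT.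
apply: le_trans (_ : 1 + L%:R * e <= _); first by rewrite -natr1; lra.
elim: L => [|L IH]; first by rewrite mul0r addr0 expr0.
rewrite exprSr; apply: le_trans (_ : (1 + L%:R * e) * (1 + e) <= _).
  have : 0 <= L%:R * e * e by rewrite !mulr_ge0// ltW.
  rewrite -natr1; lra.
apply: ler_pM => //; first by rewrite addr_ge0// mulr_ge0// ltW.
by rewrite addr_ge0// ltW.
Qed.

(** Induction on [p]: the geometric factor is split into two powers of [Num.sqrt r], one of which
    pays for a factor [L.+1]. *)
Lemma pow_exp_bounded (R : realType) (p : nat) (r : R) : 0 < r < 1 ->
  exists2 C, 0 <= C & forall L, L.+1%:R ^+ p * r ^+ L <= C.
Proof.
elim: p r => [|p IH] r /andP[r0 r1].
  by exists 1 => // L; rewrite expr0 mul1r exprn_ile1// ltW.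
have s01 : 0 < Num.sqrt r < 1.
  by rewrite sqrtr_gt0 r0 -[ltRHS](sqrtr1 R) ltr_sqrt.
have [C C0 h] := IH _ s01; have [C' C'0 h'] := linear_exp_bounded s01.
have [s0 _] := andP s01.
exists (C' * C) => [|L]; first exact: mulr_ge0.
have -> : L.+1%:R ^+ p.+1 * r ^+ L =
    (L.+1%:R * Num.sqrt r ^+ L) * (L.+1%:R ^+ p * Num.sqrt r ^+ L).
  by rewrite -{1}(sqr_sqrtr (ltW r0)) -exprM mulnC muln2 -addnn exprD exprS; ring.
by apply: ler_pM; rewrite ?mulr_ge0 ?exprn_ge0// ltW.
Qed.

Section DeltaConstants.
Context (R : realType) (N : nat) (lo hi : 'I_N -> R) (X : lmodType R).
Hypothesis lohi : forall n, lo n < hi n.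

Lemma Delta_polydeg (j : mindex N) n (v : 'rV[R]_N -> X) :
  polydeg n (level (j n).-1) v -> Delta lo hi j v = 0.
Proof.
move=> vn; rewrite (rest_Delta _ _ n) detailE interp_polydeg//; last first.
  by apply: polydeg_le vn; apply: level_le; exact: leq_pred.
by rewrite interp_polydeg// subrr /rest details0.
Qed.

Lemma Delta_cst (j : mindex N) (c : X) : (forall n, 0 < j n)%N ->
  Delta lo hi j (fun=> c) = if j == [ffun=> 1%N] then fun=> c else 0.
Proof.
move=> j0; case: eqP => [->|/eqP j1].
  rewrite DeltaE; elim: (enum 'I_N) => //= n r ->.
  by rewrite ffunE detailE interp0 subr0 interp_polydeg//; exact: polydeg_cst.
have [k jk] : exists k, (1 < j k)%N.
  apply/existsP; apply: contraNT j1 => /existsPn h; apply/eqP/ffunP => k; rewrite ffunE.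
  by have := h k; have := j0 k; case: (j k) => [|[|]].
apply: (@Delta_polydeg j k); apply: (@polydeg_le _ _ _ _ 1); last exact: polydeg_cst.
by case: (j k) jk => // -[|m] // _; apply: (@leq_trans (level 1)) => //; exact: level_le.
Qed.

Lemma Ssum_cst (s : seq (mindex N)) (c : X) : uniq s ->
  {in s, forall (j : mindex N) n, 0 < j n}%N ->
  [ffun=> 1%N] \in s -> Ssum lo hi s (fun=> c) = fun=> c.
Proof.
move=> us s0 s1; rewrite /Ssum (bigD1_seq [ffun=> 1%N])//= big_seq_cond big1 ?addr0.
  by rewrite Delta_cst ?eqxx//; apply: s0.
by move=> j /andP[sj /negbTE j1]; rewrite Delta_cst ?j1//; apply: s0.
Qed.

End DeltaConstants.

(* In the application [X] consists of all vector fields, [W] of the square-integrable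
   ones, and [ip] is the L^2 inner product, which is bilinear only on [W] and
   degenerate on functions that vanish almost everywhere. *)
Section Energy.
Context (R : realType) (N : nat) (lo hi : 'I_N -> R) (X : lmodType R) (W : set X)
  (ip : X -> X -> R) (A0 : {linear X -> X}) (A : 'I_N -> {linear X -> X})
  (amin amax KA : R) (u : 'rV[R]_N -> X) (Phi : 'rV[R]_N -> R).
Local Notation Gam := (Gam lo hi).

Definition energy_op (y : 'rV[R]_N) x : X := A0 x + \sum_n y 0 n *: A n x.

Hypothesis lohi : forall n, lo n < hi n.
Hypotheses (W0 : W 0) (WZD : forall a x z, W x -> W z -> W (a *: x + z)).
Hypothesis ipC : forall x z, ip x z = ip z x.
Hypothesis ip_lin : forall a x x' z, W x -> W x' -> W z ->
  ip (a *: x + x') z = a * ip x z + ip x' z.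
Hypothesis ip_ge0 : forall x, W x -> 0 <= ip x x.
Hypotheses (WA0 : forall x, W x -> W (A0 x)) (WA : forall n x, W x -> W (A n x)).
Hypothesis A0_sym : forall x z, W x -> W z -> ip (A0 x) z = ip x (A0 z).
Hypothesis A_sym : forall n x z, W x -> W z -> ip (A n x) z = ip x (A n z).
Hypotheses (amin0 : 0 < amin) (aminmax : amin <= amax) (KA0 : 0 <= KA).
Hypothesis ellip : forall y x, Gam y -> W x ->
  amin * ip x x <= ip (energy_op y x) x <= amax * ip x x.
Hypothesis A_le : forall n x, W x -> ip (A n x) (A n x) <= KA ^+ 2 * ip x x.
Hypothesis Wu : forall y, Gam y -> W (u y).
Hypothesis solves : forall y p, Gam y -> Gam p -> ip (energy_op y (u y)) (u p) = Phi p.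

Definition nrm x := Num.sqrt (ip x x).

Lemma nrm_ge0 x : 0 <= nrm x. Proof. exact: sqrtr_ge0. Qed.

Lemma sqr_nrm x : W x -> nrm x ^+ 2 = ip x x.
Proof. by move=> Wx; rewrite sqr_sqrtr// ip_ge0. Qed.

Lemma WD x z : W x -> W z -> W (x + z).
Proof. by move=> Wx Wz; rewrite -[x]scale1r; exact: WZD. Qed.

Lemma WZ a x : W x -> W (a *: x).
Proof. by move=> Wx; rewrite -[a *: x]addr0; exact: WZD. Qed.

Lemma W_sum (J : eqType) (r : seq J) (P : pred J) (F : J -> X) :
  (forall j, j \in r -> P j -> W (F j)) -> W (\sum_(j <- r | P j) F j).
Proof.
by move=> h; rewrite big_seq_cond; apply: big_ind => //; [exact: WD|move=> j /andP[]; exact: h].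
Qed.

Lemma ipDl x x' z : W x -> W x' -> W z -> ip (x + x') z = ip x z + ip x' z.
Proof. by move=> ? ? ?; rewrite -[x]scale1r ip_lin// mul1r scale1r. Qed.

Lemma ip0l z : W z -> ip 0 z = 0.
Proof. by move=> Wz; have := ip_lin (-1) W0 W0 Wz; rewrite scaler0 addr0; lra. Qed.

Lemma ipZl a x z : W x -> W z -> ip (a *: x) z = a * ip x z.
Proof. by move=> ? ?; rewrite -[a *: x]addr0 ip_lin// ip0l// addr0. Qed.

Lemma ip_linr a x x' z : W x -> W x' -> W z -> ip z (a *: x + x') = a * ip z x + ip z x'.
Proof. by move=> ? ? ?; rewrite !(ipC z) ip_lin. Qed.

Lemma ipBl x x' z : W x -> W x' -> W z -> ip (x - x') z = ip x z - ip x' z.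
Proof.
by move=> ? ? ?; rewrite addrC -scaleN1r ip_lin// mulN1r addrC.
Qed.

Lemma ip_suml (J : eqType) (r : seq J) (P : pred J) (F : J -> X) z :
  (forall j, j \in r -> P j -> W (F j)) -> W z ->
  ip (\sum_(j <- r | P j) F j) z = \sum_(j <- r | P j) ip (F j) z.
Proof.
move=> + Wz; elim: r => [|j r IH] h; first by rewrite !big_nil ip0l.
have h' k : k \in r -> P k -> W (F k) by move=> kr; apply: h; rewrite inE kr orbT.
rewrite !big_cons; case: ifPn => Pj; last exact: IH.
by rewrite ipDl ?IH//; [apply: h => //; exact: mem_head|exact: W_sum].
Qed.

Lemma ip_CS x z : W x -> W z -> `|ip x z| <= nrm x * nrm z.
Proof.
move=> Wx Wz; rewrite -(ler_pXn2r (ltn0Sn 1)) ?nnegrE ?mulr_ge0 ?nrm_ge0//.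
rewrite exprMn !sqr_nrm// real_normK ?num_real//.
apply: discriminant_le0 => [|t]; first exact: ip_ge0.
have -> : ip x x + 2 * ip x z * t + ip z z * t ^+ 2 = ip (t *: z + x) (t *: z + x).
  have Wzx := WZD t Wz Wx.
  by rewrite ip_lin// !ip_linr// (ipC z x); ring.
exact/ip_ge0/WZD.
Qed.

Lemma nrmD x z : W x -> W z -> nrm (x + z) <= nrm x + nrm z.
Proof.
move=> Wx Wz; have Wxz := WD Wx Wz.
rewrite -(ler_pXn2r (ltn0Sn 1)) ?nnegrE ?addr_ge0 ?nrm_ge0// sqr_nrm//.
have -> : ip (x + z) (x + z) = ip x x + ip z z + 2 * ip x z.
  by rewrite ipDl// !(ipC _ (x + z)) !ipDl// (ipC z x); ring.
have := ip_CS Wx Wz; have := ler_norm (ip x z); rewrite sqrrD !sqr_nrm//.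
lra.
Qed.

Lemma nrmZ a x : W x -> nrm (a *: x) = `|a| * nrm x.
Proof.
move=> Wx; rewrite /nrm ipZl//; last exact: WZ.
by rewrite ipC ipZl// mulrA -expr2 sqrtrM ?sqr_ge0// sqrtr_sqr.
Qed.

Lemma nrm0 : nrm 0 = 0.
Proof. by rewrite /nrm ip0l// sqrtr0. Qed.

Lemma nrm_sum (J : eqType) (r : seq J) (P : pred J) (F : J -> X) :
  (forall j, j \in r -> P j -> W (F j)) ->
  nrm (\sum_(j <- r | P j) F j) <= \sum_(j <- r | P j) nrm (F j).
Proof.
elim: r => [|j r IH] h; first by rewrite !big_nil nrm0.
have h' k : k \in r -> P k -> W (F k) by move=> kr; apply: h; rewrite inE kr orbT.
rewrite !big_cons; case: ifPn => Pj; last exact: IH.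
apply: le_trans (nrmD _ _) _; rewrite ?lerD2l ?IH//; last exact: W_sum.
by apply: h => //; exact: mem_head.
Qed.

Lemma W_eval r (v : 'rV[R]_N -> X) : (forall q, q \in r -> W (v q.2)) -> W (eval r v).
Proof. by move=> h; apply: W_sum => q qr _; apply/WZ/h. Qed.

Lemma nrm_eval r (v : 'rV[R]_N -> X) C : (forall q, q \in r -> W (v q.2) /\ nrm (v q.2) <= C) ->
  nrm (eval r v) <= weight r * C.
Proof.
move=> h; apply: (le_trans (nrm_sum _)); first by move=> q /h[? _] _; apply: WZ.
rewrite /weight mulr_suml big_seq [leRHS]big_seq; apply: ler_sum => q /h[Wv vC].
by rewrite nrmZ// ler_wpM2l.
Qed.

Lemma ip_eval r (v : 'rV[R]_N -> X) z : (forall q, q \in r -> W (v q.2)) -> W z ->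
  ip (eval r v) z = eval r (fun p => ip (v p) z : R^o).
Proof.
move=> h Wz; rewrite ip_suml//; last by move=> q /h ? _; apply: WZ.
by rewrite /eval big_seq [RHS]big_seq; apply: eq_bigr => q qr; rewrite ipZl//; apply: h.
Qed.

Lemma W_Delta i v y : Gam y -> (forall p, Gam p -> W (v p)) -> W (Delta lo hi i v y).
Proof.
move=> Gy Wv; have [r [rG _ ->]] := samples_Delta lohi i Gy.
by apply: W_eval => q /rG/Wv.
Qed.

Lemma nrm_Delta i v y C : Gam y -> (forall p, Gam p -> W (v p)) ->
  (forall p, Gam p -> nrm (v p) <= C) -> 0 <= C ->
  nrm (Delta lo hi i v y) <= \prod_n (4 * 2 ^+ i n) * C.
Proof.
move=> Gy Wv vC C0; have [r [rG rB ->]] := samples_Delta lohi i Gy.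
apply: (le_trans (nrm_eval (C := C) _)); last by rewrite ler_wpM2r.
by move=> q /rG Gq; split; [exact: Wv|exact: vC].
Qed.

Lemma Delta_linear (f : {linear X -> X}) i v y : Gam y ->
  Delta lo hi i (f \o v) y = f (Delta lo hi i v y).
Proof.
by move=> Gy; have [r [rG rB rE]] := samples_Delta lohi i Gy; rewrite !rE raddf_eval.
Qed.

Let Gam_lo : Gam (\row_n lo n).
Proof. by move=> n; rewrite mxE lexx ltW. Qed.

Lemma W_energy_op y x : W x -> W (energy_op y x).
Proof. by move=> Wx; apply: WD; [exact: WA0|apply: W_sum => n _ _; apply/WZ/WA]. Qed.

Lemma energy_opC y x z : W x -> W z -> ip (energy_op y x) z = ip (energy_op y z) x.
Proof.
move=> Wx Wz; rewrite !ipDl ?ip_suml//; try exact: WA0;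
  try (by move=> *; apply/WZ/WA); try (by apply: W_sum => *; apply/WZ/WA).
rewrite A0_sym// ipC; congr (_ + _); apply: eq_bigr => n _.
have [Wnx Wnz] := (WA n Wx, WA n Wz); by rewrite !ipZl // A_sym // ipC.
Qed.

Lemma energy_op_lin y a x z : energy_op y (a *: x + z) = a *: energy_op y x + energy_op y z.
Proof.
rewrite /energy_op linearP scalerDr addrACA; congr (_ + _).
rewrite scaler_sumr -big_split; apply: eq_bigr => n _ /=.
by rewrite linearP scalerDr !scalerA mulrC.
Qed.

Lemma energy_op_ge0 y x : Gam y -> W x -> 0 <= ip (energy_op y x) x.
Proof.
by move=> Gy Wx; have /andP[+ _] := ellip Gy Wx; apply: le_trans; rewrite mulr_ge0 ?ip_ge0// ltW.
Qed.

Lemma energy_CS y x z : Gam y -> W x -> W z ->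
  ip (energy_op y x) z ^+ 2 <= (amax * ip x x) * (amax * ip z z).
Proof.
move=> Gy Wx Wz; have Wxy := W_energy_op y Wx; have Wzy := W_energy_op y Wz.
have := @discriminant_le0 R (ip (energy_op y x) x) (ip (energy_op y x) z)
  (ip (energy_op y z) z) (energy_op_ge0 Gy Wz) => h.
apply: (le_trans (h _)) => [t|].
  have -> : ip (energy_op y x) x + 2 * ip (energy_op y x) z * t +
     ip (energy_op y z) z * t ^+ 2 = ip (energy_op y (t *: z + x)) (t *: z + x).
    have Wzx := WZD t Wz Wx.
    by rewrite energy_op_lin ip_lin// !ip_linr// (energy_opC y Wz Wx); ring.
  exact/energy_op_ge0/WZD.
have /andP[_ h1] := ellip Gy Wx; have /andP[_ h2] := ellip Gy Wz.
by apply: ler_pM => //; exact: energy_op_ge0.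
Qed.

(** The load tested with [u y] equals both the energy of [u y] at parameter [y] and the form at [y0]
    applied to [u y0] and [u y]. So [u y] is compared with the single solution [u y0], and no dual
    norm of the load enters. *)
Lemma solution_bounded : exists2 C, 0 <= C & forall y, Gam y -> nrm (u y) <= C.
Proof.
pose y0 : 'rV[R]_N := \row_n lo n; have amax0 := lt_le_trans amin0 aminmax.
exists (amax / amin * nrm (u y0)) => [|y Gy].
  by rewrite mulr_ge0 ?nrm_ge0// divr_ge0// ltW.
have [->|n0] := eqVneq (nrm (u y)) 0.
  by rewrite mulr_ge0 ?nrm_ge0// divr_ge0// ltW.
have {}n0 : 0 < nrm (u y) by rewrite lt_def n0 nrm_ge0.
have /andP[h _] := ellip Gy (Wu Gy).
have := energy_CS Gam_lo (Wu Gam_lo) (Wu Gy).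
rewrite solves// -(solves Gy Gy) -/y0 => h2.
have : (amin * nrm (u y) ^+ 2) ^+ 2 <= (amax * nrm (u y0) * nrm (u y)) ^+ 2.
  have Wy := Wu Gy; have Wy0 := Wu Gam_lo; have ey := energy_op_ge0 Gy Wy.
  apply: le_trans (_ : _ <= ip (energy_op y (u y)) (u y) ^+ 2) _.
    by rewrite sqr_nrm// ler_pXn2r// nnegrE mulr_ge0 ?ip_ge0// ltW.
  apply: (le_trans h2); rewrite -!sqr_nrm//.
  by rewrite le_eqVlt; apply/orP; left; apply/eqP; ring.
rewrite ler_pXn2r ?nnegrE ?mulr_ge0 ?exprn_ge0 ?nrm_ge0 ?(ltW amin0) ?(ltW amax0)//.
rewrite expr2 mulrA ler_pM2r// -ler_pdivlMl// => h3.
by apply: (le_trans h3); rewrite mulrA [_^-1 * _]mulrC.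
Qed.

Lemma W_neg x : W x -> W (- x).
Proof. by move=> ?; rewrite -scaleN1r; exact: WZ. Qed.

(** * Gram matrices on the span of finitely many elements *)

Section Gram.
Context (m : nat) (w : 'I_m -> X).
Hypothesis Ww : forall k, W (w k).

Definition combine (x : 'rV[R]_m) : X := \sum_k x 0 k *: w k.

Lemma W_combine x : W (combine x).
Proof. by apply: W_sum => k _ _; apply: WZ. Qed.

Lemma combine_delta k : combine (delta_mx 0 k) = w k.
Proof.
rewrite /combine (bigD1 k)//= mxE !eqxx scale1r big1 ?addr0// => l lk.
by rewrite mxE (negbTE lk) andbF scale0r.
Qed.

Lemma combine_eval (J : Type) (r : seq J) (c : J -> R) (x : J -> 'rV[R]_m) :
  combine (\sum_(j <- r) c j *: x j) = \sum_(j <- r) c j *: combine (x j).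
Proof.
under [RHS]eq_bigr do rewrite scaler_sumr.
rewrite exchange_big; apply: eq_bigr => k _.
by rewrite summxE scaler_suml; apply: eq_bigr => j _; rewrite mxE scalerA.
Qed.

(** [B = id] gives the Gram matrix, [B = energy_op y] the stiffness matrix on the span. *)
Lemma form_gram (B : X -> X) : (forall a x z, B (a *: x + z) = a *: B x + B z) ->
  (forall x, W x -> W (B x)) -> forall x z,
  form (\matrix_(k, l) ip (B (w k)) (w l)) x z = ip (B (combine x)) (combine z).
Proof.
move=> Blin WB x z.
have B0 : B 0 = 0 by have := Blin (-1) 0 0; rewrite !scaleN1r oppr0 addr0 addNr.
have -> : B (combine x) = \sum_k x 0 k *: B (w k).
  rewrite /combine; elim/big_ind2 : _ => // [a b c e <- <-|k _].
    by rewrite -[b]scale1r Blin !scale1r.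
  by rewrite -[_ *: w k]addr0 Blin B0 addr0.
rewrite ip_suml; [|by move=> *; apply/WZ/WB|exact: W_combine].
rewrite /form mxE; under eq_bigr do rewrite mxE mulr_suml.
rewrite exchange_big; apply: eq_bigr => k _ /=.
rewrite ipZl; [|exact/WB|exact: W_combine].
rewrite ipC ip_suml; [|by move=> *; apply: WZ|exact: WB].
rewrite mulr_sumr; apply: eq_bigr => l _.
rewrite !mxE ipZl//; [rewrite (ipC (w l)); ring|exact: WB].
Qed.

End Gram.

(* Working in the span of the finitely many sampled solutions, where Riesz
   representatives come from the Gram matrix, avoids the completeness of H^1_0. *)
Lemma detail_decay : exists C rho : R, [/\ 0 <= C, 0 < rho < 1 & forall j n y, Gam y ->
  nrm (Delta lo hi j u y) <= C * \prod_k (4 * 2 ^+ j k) * rho ^+ level (j n).-1].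
Proof.
have [C0 C00 uC] := solution_bounded.
have amax0 := lt_le_trans amin0 aminmax.
pose q := 1 - 3 / 4 * (amin / amax) ^+ 2.
have q01 : 0 < q < 1.
  have a1 : 0 < (amin / amax) ^+ 2 by rewrite exprn_gt0// divr_gt0.
  have a2 : (amin / amax) ^+ 2 <= 1.
    by rewrite expr_le1// ?ler_pdivrMr ?mul1r// divr_ge0// ltW.
  by rewrite /q; apply/andP; split; lra.
have [q0 q1] := andP q01.
(* [q] contracts squared norms, hence the square root. *)
exists C0, (Num.sqrt q); split=> //.
  by rewrite sqrtr_gt0 q0 -[ltRHS](sqrtr1 R) ltr_sqrt.
move=> j n y Gy; have [r [rG rB rE]] := samples_Delta lohi j Gy.
pose p (k : 'I_(size r)) := (tnth (in_tuple r) k).2.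
have Gp k : Gam (p k) by apply: rG; exact: mem_tnth.
have Wp k : W (u (p k)) by exact: Wu.
pose w k := u (p k).
pose G := \matrix_(k, l) ip (w k) (w l).
pose M0 := \matrix_(k, l) ip (A0 (w k)) (w l).
pose M n := \matrix_(k, l) ip (A n (w k)) (w l).
have GE x z : form G x z = ip (combine w x) (combine w z).
  exact: (form_gram Wp (B := id)).
have ME (y' : 'rV[R]_N) : M0 + \sum_n y' 0 n *: M n = \matrix_(k, l) ip (energy_op y' (w k)) (w l).
  apply/matrixP => k l; rewrite !mxE summxE /energy_op ipDl; last exact: Wp.
  - rewrite ip_suml; [|by move=> *; apply/WZ/WA/Wp|exact: Wp].
    by congr (_ + _); apply: eq_bigr => i _; rewrite !mxE ipZl//; [exact/WA/Wp|exact: Wp].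
  - exact/WA0/Wp.
  - by apply: W_sum => *; apply/WZ/WA/Wp.
have MEf (y' : 'rV[R]_N) x z : form (M0 + \sum_n y' 0 n *: M n) x z =
    ip (energy_op y' (combine w x)) (combine w z).
  rewrite ME; apply: (form_gram Wp) => [a x' z'|x']; first exact: energy_op_lin.
  exact: W_energy_op.
have Wc x : W (combine w x) by exact: (W_combine Wp).
(* As many steps as [Delta_polydeg] allows if the iterate is still to be annihilated. *)
have [||||||v vK vE] := @richardson R _ N Gam G M0 M (\row_l Phi (p l)) p amin amax (C0 ^+ 2)
    _ _ _ amin0 aminmax _ Gp _ _ n (level (j n).-1).
- by apply/matrixP => k l; rewrite !mxE ipC.
- by move=> x; rewrite GE ip_ge0.
- move=> y' _; rewrite ME; apply/matrixP => k l; rewrite !mxE energy_opC//; exact: Wp.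
- by move=> y' x Gy'; rewrite GE MEf; apply: ellip.
- by move=> k; rewrite ME; apply/rowP => l; rewrite !mxE solves.
- move=> k; rewrite GE combine_delta -sqr_nrm; last exact: Wp.
  by rewrite ler_pXn2r ?nnegrE ?nrm_ge0// uC.
(* The annihilated iterate can be subtracted from the coefficient vectors without changing the
   detail. *)
have rv : \sum_(k < size r) (tnth (in_tuple r) k).1 *: v (p k) = 0.
  have : Delta lo hi j v y = 0 by rewrite (Delta_polydeg lohi vK).
  by rewrite rE /eval big_tnth.
have -> : Delta lo hi j u y =
    \sum_(k < size r) (tnth (in_tuple r) k).1 *: combine w (delta_mx 0 k - v (p k)).
  rewrite -combine_eval.
  under [in RHS]eq_bigr do rewrite scalerBr.
  rewrite sumrB rv subr0 combine_eval rE /eval big_tnth.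
  by apply: eq_bigr => k _; rewrite combine_delta.
apply: (le_trans (nrm_sum _)) => [k _ _|]; first exact: WZ.
rewrite -mulrA [leRHS]mulrC -mulrA.
apply: le_trans (_ : weight r * (Num.sqrt q ^+ level (j n).-1 * C0) <= _); last first.
  by rewrite ler_wpM2r// mulr_ge0// exprn_ge0// sqrtr_ge0.
rewrite /weight mulr_suml [leRHS]big_tnth; apply: ler_sum => k _.
rewrite nrmZ// ler_wpM2l// -(ler_pXn2r (ltn0Sn 1)) ?nnegrE ?nrm_ge0//; last first.
  by rewrite mulr_ge0// exprn_ge0// sqrtr_ge0.
rewrite sqr_nrm// -GE; apply: (le_trans (vE k)).
by rewrite -/q [leRHS]exprMn -exprM mulnC exprM sqr_sqrtr// ltW.
Qed.

Lemma Gam_bounded : exists2 Y, 0 <= Y & forall y n, Gam y -> `|y 0 n| <= Y.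
Proof.
exists (\sum_n (`|lo n| + `|hi n|)) => [|y n Gy]; first by apply: sumr_ge0 => n _; rewrite addr_ge0.
have h : `|y 0 n| <= `|lo n| + `|hi n|.
  have /andP[h1 h2] := Gy n; rewrite ler_norml; apply/andP; split.
    have := lerNnormlW (lexx `|lo n|); have := normr_ge0 (hi n); lra.
  have := ler_norm (hi n); have := normr_ge0 (lo n); lra.
by rewrite (bigD1 n)//= (le_trans h)// lerDl sumr_ge0// => k _; rewrite addr_ge0.
Qed.

Let flux s := flux_on lo hi (A0 \o u) (fun n => A n \o u) s.

(** Each [n] contributes at most the neighbour [decr i n]. The Lebesgue constants are powers of the
    [2 ^ i k], all dominated by the largest coordinate, and the decay in that coordinate beats them
    with enough room left for the factor [2^-1 ^+ i n]. *)
Lemma flux_bound : (0 < N)%N -> exists2 C, 0 <= C & forall (s : seq (mindex N)) (i : mindex N) y,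
  uniq s -> {in s, forall (j : mindex N) n, 0 < j n}%N -> (forall n, 0 < i n)%N -> i \notin s ->
  Gam y -> nrm (Delta lo hi i (flux s) y) <= C * \prod_n 2^-1 ^+ i n.
Proof.
move=> N0; have [C1 [rho [C10 rho01 dec]]] := detail_decay.
have [Y Y0 yY] := Gam_bounded.
(* Two factors [4 * 2 ^+ i k] and the division by [2^-1 ^+ i k] make [16 * 8 ^+ i k] per coordinate,
   and [8 ^ i k <= (8 * L.+1) ^ 3] for the [L] below: a power [3 * N] in total. *)
have [C2 C20 powC] := pow_exp_bounded (3 * N) rho01.
have [rho0 _] := andP rho01.
have c_ge0 : 0 <= 16 * 8 ^+ 3 :> R by rewrite mulr_ge0 ?exprn_ge0 ?ler0n.
exists (N%:R * (Y * KA * C1 * ((16 * 8 ^+ 3) ^+ N * C2))).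
  apply: mulr_ge0; first exact: ler0n.
  apply: mulr_ge0; first by rewrite !mulr_ge0.
  by apply: mulr_ge0; [exact: exprn_ge0 c_ge0|exact: C20].
move=> s i y us s0 i0 si Gy.
pose k0 := [arg max_(k > Ordinal N0) i k]%N.
have ik0 k : (i k <= i k0)%N by rewrite /k0; case: arg_maxnP => // l _; apply.
pose L := level (i k0 - 2).
pose Pi : R := \prod_k (4 * 2 ^+ i k).
have Pi0 : 0 <= Pi by apply: prodr_ge0 => k _; rewrite mulr_ge0// exprn_ge0.
(* One [Pi] bounds the operator [Delta i], the other comes from the decay estimate for the detail
   [j]. *)
pose T := Pi * (Y * (KA * (C1 * Pi * rho ^+ L))).
have T0 : 0 <= T by rewrite !mulr_ge0// exprn_ge0// ltW.
have term n j : incr j n = i -> W (Delta lo hi i (mulcoord n (Delta lo hi j (A n \o u))) y) /\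
    nrm (Delta lo hi i (mulcoord n (Delta lo hi j (A n \o u))) y) <= T.
  move=> ji.
  have Wj p : Gam p -> W (Delta lo hi j u p) by move=> Gp; apply: W_Delta.
  have h p : Gam p -> W (mulcoord n (Delta lo hi j (A n \o u)) p) /\
      nrm (mulcoord n (Delta lo hi j (A n \o u)) p) <= Y * (KA * (C1 * Pi * rho ^+ L)).
    move=> Gp; rewrite /mulcoord Delta_linear//.
    have WAj : W (A n (Delta lo hi j u p)) by apply/WA/Wj.
    split; first exact: WZ.
    rewrite nrmZ//; apply: ler_pM; rewrite ?nrm_ge0//; first exact: yY.
    apply: le_trans (_ : KA * nrm (Delta lo hi j u p) <= _).
      rewrite -(ler_pXn2r (ltn0Sn 1)) ?nnegrE ?mulr_ge0 ?nrm_ge0//.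
      by have Wjp := Wj p Gp; rewrite exprMn !sqr_nrm//; exact: A_le.
    rewrite ler_wpM2l// (le_trans (dec j k0 p Gp))//.
    have jle k : (j k <= i k)%N by rewrite -ji ffunE leq_addr.
    apply: ler_pM; rewrite ?mulr_ge0 ?exprn_ge0 ?(ltW rho0)//.
    - by apply: prodr_ge0 => k _; rewrite mulr_ge0// exprn_ge0.
    - rewrite ler_wpM2l//; apply: ler_prod => k _; rewrite mulr_ge0 ?exprn_ge0//=.
      by rewrite ler_wpM2l// ler_weXn2l// ler1n.
    - have [_ rho1] := andP rho01; apply: ler_wiXn2l; rewrite ?(ltW rho0) ?(ltW rho1)//.
      by apply: level_le; rewrite -ji ffunE; exact: addb_sub2_le.
  split; first by apply: W_Delta => // p /h[].
  apply: nrm_Delta => // [p /h[]//|p /h[]//|].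
  by rewrite !mulr_ge0// exprn_ge0// ltW.
rewrite Delta_flux_off// fct_sumE.
have -> : \sum_n (\sum_(j <- s | incr j n == i)
     Delta lo hi i (mulcoord n (Delta lo hi j (A n \o u)))) y =
   \sum_n \sum_(j <- s | incr j n == i)
     Delta lo hi i (mulcoord n (Delta lo hi j (A n \o u))) y.
  by apply: eq_bigr => n _; rewrite fct_sumE.
apply: (le_trans (nrm_sum _)) => [n _ _|].
  by apply: W_sum => j _ /eqP /term[].
apply: le_trans (_ : N%:R * T <= _).
  have -> : N%:R * T = \sum_(n < N) T by rewrite sumr_const card_ord mulr_natl.
  apply: ler_sum => n _; apply: (le_trans (nrm_sum _)) => [j _ /eqP /term[]//|].
  apply: le_trans (_ : \sum_(j <- s | incr j n == i) T <= _).
    by apply: ler_sum => j /eqP /term[].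
  rewrite big_const_seq iter_addr_0 -mulr_natr ler_piMr// (ler_nat _ _ 1).
  (* For fixed [n] the equation [incr j n = i] has at most one solution in the duplicate-free
     [s]. *)
  apply: (@leq_trans (count_mem (decr i n) s)).
    by apply: sub_count => j /eqP <- /=; rewrite decr_incr.
  by rewrite count_uniq_mem// leq_b1.
rewrite -[leRHS]mulrA ler_wpM2l//.
have -> : T = Y * KA * C1 * (Pi ^+ 2 * rho ^+ L) by rewrite /T; ring.
rewrite -[leRHS]mulrA ler_wpM2l ?mulr_ge0//.
rewrite -ler_pdivrMr; last by apply: prodr_gt0 => k _; rewrite exprn_gt0.
have -> : Pi ^+ 2 * rho ^+ L / \prod_n 2^-1 ^+ i n = \prod_k (16 * 8 ^+ i k) * rho ^+ L.
  rewrite mulrAC; congr (_ * _); rewrite -prodrXl -prodfV -big_split.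
  apply: eq_bigr => k _ /=; rewrite exprVn invrK.
  have -> : 8 ^+ i k = (2 ^+ i k) ^+ 3 :> R.
    by rewrite -exprM mulnC exprM; congr (_ ^+ _); ring.
  ring.
apply: le_trans (_ : ((16 * 8 ^+ 3) * L.+1%:R ^+ 3) ^+ N * rho ^+ L <= _); last first.
  by rewrite exprMn -exprM -mulrA ler_wpM2l ?exprn_ge0// powC.
rewrite ler_wpM2r ?exprn_ge0 ?(ltW rho0)//.
have -> : ((16 * 8 ^+ 3) * L.+1%:R ^+ 3) ^+ N = \prod_(k < N) ((16 * 8 ^+ 3) * L.+1%:R ^+ 3) :> R.
  by rewrite prodr_const card_ord.
apply: ler_prod => k _; rewrite mulr_ge0 ?exprn_ge0//= -mulrA ler_wpM2l//.
have -> : 8 ^+ 3 * L.+1%:R ^+ 3 = (8 * L.+1)%:R ^+ 3 :> R by rewrite natrM exprMn.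
have -> : 8 ^+ i k = (2 ^ i k)%:R ^+ 3 :> R.
  by rewrite natrX -exprM mulnC exprM; congr (_ ^+ _); ring.
rewrite ler_pXn2r ?nnegrE// ler_nat.
by apply: leq_trans (level_ge_exp (i k0)); rewrite leq_exp2l.
Qed.

Lemma flux_on_energy_op s y : Gam y -> flux s y = energy_op y (Ssum lo hi s u y).
Proof.
move=> Gy; rewrite /flux /flux_on /energy_op.
have SE (f : {linear X -> X}) : Ssum lo hi s (f \o u) y = f (Ssum lo hi s u y).
  by rewrite /Ssum !fct_sumE linear_sum; apply: eq_bigr => j _; rewrite Delta_linear.
transitivity (Ssum lo hi s (A0 \o u) y + (\sum_n mulcoord n (Ssum lo hi s (A n \o u))) y) => //.
by rewrite fct_sumE SE; congr (_ + _); apply: eq_bigr => n _; rewrite /mulcoord SE.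
Qed.

(** Coercivity requires testing with the error itself. The error is a combination of [u y] and of
    sampled solutions, so the residual identity is first proved against a single [u p] and then
    extended by linearity. *)
Lemma reliability (s t : seq (mindex N)) y : uniq (s ++ t) ->
  {in s ++ t, forall (j : mindex N) n, 0 < j n}%N ->
  {in s, forall j n, incr j n \in s ++ t} -> down_closed [set` s] ->
  [ffun=> 1%N] \in s -> Gam y ->
  amin * nrm (u y - Ssum lo hi s u y) <= \sum_(i <- t) nrm (Delta lo hi i (flux s) y).
Proof.
move=> ust st0 sst sdc s1 Gy.
have [us ut] : uniq s /\ uniq t by move: ust; rewrite cat_uniq => /and3P[].
have s0 : {in s, forall (j : mindex N) n, 0 < j n}%N.
  by move=> j js; apply: st0; rewrite mem_cat js.
pose e := u y - Ssum lo hi s u y.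
pose full := full_flux (A0 \o u) (fun n => A n \o u).
have fullE p : full p = energy_op p (u p).
  transitivity (A0 (u p) + (\sum_n mulcoord n (A n \o u)) p) => //.
  by rewrite fct_sumE.
have Wfull p : Gam p -> W (full p) by move=> Gp; rewrite fullE; apply/W_energy_op/Wu.
have WSu p : Gam p -> W (Ssum lo hi s u p).
  by move=> Gp; rewrite /Ssum fct_sumE; apply: W_sum => j _ _; apply: W_Delta.
have We : W e by apply: WD; [exact: Wu|exact/W_neg/WSu].
have Wflux p : Gam p -> W (flux s p) by move=> Gp; rewrite flux_on_energy_op//; apply/W_energy_op/WSu.
pose rho := \sum_(i <- t) Delta lo hi i (flux s) y.
have Wr : W rho by apply: W_sum => i _ _; apply: W_Delta.
have fluxE : flux s y = \sum_(i <- s) Delta lo hi i full y + rho.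
  rewrite {1}/flux (flux_on_sum lohi _ _ ust st0 sst) fct_sumE big_cat; congr (_ + _).
  by apply: eq_big_seq => i si; rewrite Delta_flux_on.
have key z : W z -> (exists2 p, Gam p & z = u p) -> ip (energy_op y e) z = - ip rho z.
  move=> Wz [p Gp zp].
  have -> : energy_op y e = energy_op y (u y) - flux s y.
    rewrite flux_on_energy_op// /e addrC -scaleN1r energy_op_lin scaleN1r addrC.
    by [].
  have WS : W (\sum_(i <- s) Delta lo hi i full y) by apply: W_sum => i _ _; apply: W_Delta.
  have Wey : W (energy_op y (u y)) by exact/W_energy_op/Wu.
  rewrite fluxE opprD addrA ipBl//; last by apply: WD => //; exact: W_neg.
  suff -> : ip (energy_op y (u y) - \sum_(i <- s) Delta lo hi i full y) z = 0 by lra.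
  rewrite ipBl//.
  rewrite ip_suml//; last by move=> *; apply: W_Delta.
  rewrite {1}zp solves// (eq_big_seq (fun i => Delta lo hi i (fun=> Phi p : R^o) y)); last first.
    move=> i _; have [r [rG _ rE]] := samples_Delta lohi i Gy; rewrite !rE ip_eval//.
      rewrite /eval big_seq [RHS]big_seq; apply: eq_bigr => q /rG Gq.
      by rewrite fullE zp solves.
    by move=> q /rG/Wfull.
  (* Tested with [u p], the full flux is the constant [Phi p] in [y], and its details over [s] sum
     to it because [s] contains the index of ones. *)
  have := Ssum_cst (X := R^o) lohi (Phi p) us s0 s1.
  move=> /(congr1 (fun g => g y)); by rewrite /Ssum fct_sumE => ->; rewrite subrr.
have keye : ip (energy_op y e) e = - ip rho e.
  have Wye := W_energy_op y We.
  pose K z := W z /\ ip (energy_op y e) z = - ip rho z.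
  have Ku p : Gam p -> K (u p) by move=> Gp; split; [exact: Wu|apply: key; [exact: Wu|exists p]].
  have KZD a x z : K x -> K z -> K (a *: x + z).
    move=> [Wx hx] [Wz hz]; split; first exact: WZD.
    by rewrite !ip_linr// hx hz; ring.
  have K0 : K 0 by split=> //; rewrite !(ipC _ 0) !ip0l// oppr0.
  have Kev r : (forall q, q \in r -> Gam q.2) -> K (eval r u).
    move=> rG; rewrite /eval big_seq; elim/big_ind : _ => // [x z Kx Kz|q /rG Gq].
      by rewrite -[x]scale1r; exact: KZD.
    by rewrite -[_ *: _]addr0; apply: (KZD _ _ _) => //; exact: (Ku _ Gq).
  suff [] : K e by [].
  rewrite /e addrC -scaleN1r; apply: (KZD _ _ _); last exact: (Ku y Gy).
  rewrite /Ssum fct_sumE; elim/big_ind : _ => // [x z Kx Kz|i _].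
    by rewrite -[x]scale1r; exact: KZD.
  by have [r [rG _ ->]] := samples_Delta lohi i Gy; exact: Kev.
have [n0|n0] := eqVneq (nrm e) 0.
  by rewrite -/e n0 mulr0 sumr_ge0// => i _; exact: nrm_ge0.
have {}n0 : 0 < nrm e by rewrite lt_def n0 nrm_ge0.
rewrite -(ler_pM2r n0) -mulrA -expr2 sqr_nrm//.
have /andP[h _] := ellip Gy We; apply: (le_trans h); rewrite keye.
apply: (le_trans (ler_norm _)); rewrite normrN; apply: (le_trans (ip_CS Wr We)).
by rewrite ler_wpM2r ?nrm_ge0//; apply: nrm_sum => i _ _; apply: W_Delta.
Qed.

End Energy.

(** * Multi-index sets and greedy selection *)

Section MultiIndexSets.
Context (N : nat).
Implicit Types (i j : mindex N) (n k : 'I_N) (I J : set (mindex N)).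

Definition positive i := forall n, (0 < i n)%N.

Definition admissible I :=
  [/\ finite_set I, down_closed I, I `<=` positive & I [ffun=> 1%N]].

Definition le_mindex j i := forall n, (j n <= i n)%N.

(** Passes from the one-step condition to all smaller positive indices, by induction on the total
    difference of [i] and [j]. *)
Lemma down_closed_le I i j : down_closed I -> I i -> positive j -> le_mindex j i -> I j.
Proof.
move=> Idc; have [m] := ubnP (\sum_n (i n - j n))%N.
elim: m i => // m IH i; rewrite ltnS => im Ii j0 ji.
have [->//|/eqP ij] := eqVneq j i.
have [k jk] : exists k, (j k < i k)%N.
  apply: contrapT => /forallNP h; apply: ij; apply/ffunP => k; apply/eqP.
  by rewrite eqn_leq ji leqNgt; apply/negP; exact: h.
have ik : (1 < i k)%N by apply: leq_ltn_trans jk.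
apply: (IH (decr i k)) => // [||n].
- apply: leq_trans im; rewrite (bigD1 k)//= [leqRHS](bigD1 k)//=.
  rewrite ffunE eqxx -addSn leq_add//; first by rewrite subnAC subn1 prednK ?subn_gt0.
  by apply: leq_sum => n nk; rewrite ffunE (negbTE nk) subn0.
- exact: Idc.
- by rewrite ffunE; case: eqP => [->|]; rewrite ?subn0// subn1 -ltnS prednK// ltnW.
Qed.

(** The explicit form of [completion I i] for [i] in the margin of a downward-closed [I]. *)
Definition missing I i : set (mindex N) := [set j | [/\ positive j, le_mindex j i & ~ I j]].

(** Let [decr i n] be in [I]. A missing [j] has [j n = i n], since otherwise it would lie below
    [decr i n]; therefore [decr j n] lies below [decr i n] and is in [I]. *)
Lemma missing_margin I i : down_closed I -> margin I i -> missing I i `<=` margin I.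
Proof.
move=> Idc [i0 Ii [n i1 In]] j [j0 ji Ij]; split=> //.
have jn : j n = i n.
  apply/eqP; rewrite eqn_leq ji leqNgt; apply/negP => jn; apply: Ij.
  apply: down_closed_le In j0 _ => // k; rewrite ffunE.
  by case: eqP => [->|]; rewrite ?subn0// subn1 -ltnS prednK// ltnW.
exists n; first by rewrite jn.
apply: down_closed_le In _ _ => // k; rewrite !ffunE.
  by case: eqP => [->|_]; rewrite ?subn0 ?j0// jn subn_gt0.
exact: leq_sub2r.
Qed.

Lemma down_closed_missing I i : down_closed I -> down_closed (I `|` missing I i).
Proof.
move=> Idc j [Ij|[j0 ji Ij]] n jn; first by left; exact: Idc.
have [Id|Id] := pselect (I (decr j n)); [by left|right; split=> // k; rewrite ffunE].
  by case: eqP => [->|_]; rewrite ?subn0// subn_gt0.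
exact: leq_trans (leq_subr _ _) (ji k).
Qed.

Lemma completionE I i : down_closed I -> margin I i -> completion I i = missing I i.
Proof.
move=> Idc Mi; have [i0 Ii _] := Mi; rewrite eqEsubset; split.
  apply: smallest_sub; last by move=> _ ->; split.
  by split; [exact: missing_margin|exact: down_closed_missing].
move=> j [j0 ji Ij] A [[_ Adc] iA]; have Ai : (I `|` A) i by right; exact: iA.
by have [] := down_closed_le Adc Ai j0 ji.
Qed.

Lemma finite_le_mindex i : finite_set [set j | le_mindex j i].
Proof.
pose f (g : {ffun 'I_N -> 'I_(\sum_n i n).+1}) : mindex N := [ffun n => nat_of_ord (g n)].
apply: (@sub_finite_set _ _ (f @` setT)); last by apply: finite_image; exact: finite_finset.
move=> j ji; exists [ffun n => inord (j n)] => //; apply/ffunP => n; rewrite !ffunE inordK//.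
by rewrite ltnS (leq_trans (ji n))// (bigD1 n)//= leq_addr.
Qed.

Lemma finite_missing I i : finite_set (missing I i).
Proof. by apply: sub_finite_set (finite_le_mindex i) => j []. Qed.

Lemma finite_margin I : finite_set I -> finite_set (margin I).
Proof.
move=> Ifin; apply: (@sub_finite_set _ _ (\bigcup_(n in [set: 'I_N]) ((fun j => incr j n) @` I))).
  move=> i [i0 _ [n i1 In]]; exists n => //; exists (decr i n) => //.
  by rewrite incr_decr.
by apply: bigcup_finite => [|n _]; [exact: finite_finset|exact: finite_image].
Qed.

Lemma admissible_ones : admissible [set [ffun=> 1%N]].
Proof.
split=> //; first by move=> _ -> n; rewrite ffunE.
by move=> _ -> n; rewrite ffunE.
Qed.

Lemma admissible_step I i : admissible I -> margin I i -> admissible (I `|` completion I i).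
Proof.
move=> [Ifin Idc I0 I1] Mi; rewrite completionE//; split.
- by rewrite finite_setU; split=> //; exact: finite_missing.
- exact: down_closed_missing.
- by move=> j [/I0//|[]].
- by left.
Qed.

Lemma completion_self I i : down_closed I -> margin I i -> completion I i i.
Proof. by move=> Idc Mi; rewrite completionE//; have [i0 Ii _] := Mi; split. Qed.

Lemma margin_incr I j n : admissible I -> I j -> (I `|` margin I) (incr j n).
Proof.
move=> [_ _ I0 _] Ij; have [Iij|Iij] := pselect (I (incr j n)); [by left|right; split=> //].
  by move=> k; rewrite ffunE ltn_addr// I0.
by exists n; rewrite ?decr_incr// ffunE eqxx addn1 ltnS I0.
Qed.

End MultiIndexSets.

(** * Summable majorants and greedy selection *)

Section Summation.
Context (R : realType) (T : choiceType) (zb : T -> R) (K : R).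
Hypothesis zbK : forall s, uniq s -> \sum_(x <- s) zb x <= K.

(** [X] nearly attains the supremum of the finite sums, so a list disjoint from it can add less than
    [e]. *)
Lemma summable_tail e : 0 < e -> exists2 X : seq T, uniq X &
  forall s, uniq s -> (forall x, x \in s -> x \notin X) -> \sum_(x <- s) zb x < e.
Proof.
move=> e0; pose B := [set \sum_(x <- s) zb x | s in [set s : seq T | uniq s]].
have Bsup : has_sup B.
  split; first by exists 0, [::] => //; rewrite big_nil.
  by exists K => _ [s us <-]; exact: zbK.
have [_ [X uX <-] hX] := sup_adherent e0 Bsup.
exists X => // s us sX.
have uXs : uniq (X ++ s).
  rewrite cat_uniq uX us andbT; apply/hasPn => x xs; exact: sX.
have : \sum_(x <- X ++ s) zb x <= sup B by apply: ub_le_sup; [exact: Bsup.2|exists (X ++ s)].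
rewrite big_cat/=; lra.
Qed.

Section Selection.
Context (M A : nat -> seq T) (z : T -> nat -> R) (Wb : T -> R).
Hypotheses (uM : forall l, uniq (M l)) (uA : forall l, uniq (A l)).
Hypothesis AM : forall l x, x \in A l -> x \in M l.
Hypothesis A_disj : forall x l l', x \in A l -> x \in A l' -> l = l'.
Hypothesis z_le : forall l x, x \in M l -> 0 <= z x l <= zb x.
Hypothesis Wb0 : forall x, 0 <= Wb x.
Hypothesis z_sel : forall l x, x \in M l -> z x l <= Wb x * \sum_(y <- A l) z y l.

(** Each element is selected in at most one step, so a finite list is exhausted after finitely many
    steps. *)
Lemma eventually_avoid (X : seq T) : exists l0, forall l x, (l0 <= l)%N -> x \in A l -> x \notin X.
Proof.
elim: X => [|x X [l0 h]]; first by exists 0%N.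
have [[l1 xl1]|nx] := pselect (exists l, x \in A l).
  exists (maxn l0 l1.+1) => l y; rewrite geq_max => /andP[l0l l1l] yA.
  rewrite inE negb_or (h l y)// andbT; apply: contraTneq l1l => yx.
  by rewrite -(A_disj xl1 (l' := l)) ?ltnn// -yx.
exists l0 => l y l0l yA; rewrite inE negb_or (h l y)// andbT.
by apply/eqP => yx; apply: nx; exists l; rewrite -yx.
Qed.

Lemma selected_small e : 0 < e -> exists l0, forall l, (l0 <= l)%N -> \sum_(y <- A l) z y l < e.
Proof.
move=> e0; have [X uX hX] := summable_tail e0; have [l0 h] := eventually_avoid X.
exists l0 => l l0l; apply: le_lt_trans (hX _ (uA l) _); last by move=> x; exact: h.
by rewrite big_seq [leRHS]big_seq; apply: ler_sum => y /AM /z_le /andP[].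
Qed.

(** Off a finite [X] the majorant leaves less than [e / 2]. On [X] the estimators are bounded by the
    selected sum, which tends to zero, times weights with a fixed total; [Wb] may be unbounded, so
    this works only on a finite set. *)
Lemma margin_sum_small e : 0 < e -> exists l0, forall l, (l0 <= l)%N ->
  0 <= \sum_(x <- M l) z x l < e.
Proof.
move=> e0; have e20 : 0 < e / 2 by rewrite divr_gt0.
have [X uX hX] := summable_tail e20.
pose w := 1 + \sum_(x <- X) Wb x.
have w0 : 0 < w by rewrite ltr_pwDl// sumr_ge0.
have [l0 h] := selected_small (divr_gt0 e20 w0).
exists l0 => l l0l; apply/andP; split.
  by rewrite big_seq sumr_ge0// => x /z_le /andP[].
rewrite (bigID (mem X))/=.
set p := \sum_(y <- A l) z y l.
have p0 : 0 <= p by rewrite /p big_seq sumr_ge0// => x /AM /z_le /andP[].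
have pe : p * w < e / 2 by rewrite -ltr_pdivlMr//; exact: h.
have h1 : \sum_(x <- M l | x \in X) z x l <= p * w.
  apply: le_trans (_ : \sum_(x <- M l | x \in X) Wb x * p <= _).
    by rewrite big_seq_cond [leRHS]big_seq_cond; apply: ler_sum => x /andP[xM _]; exact: z_sel.
  rewrite -mulr_suml mulrC ler_wpM2l//.
  apply: le_trans (_ : \sum_(x <- X) Wb x <= _); last by rewrite lerDr.
  rewrite -big_filter; apply: ler_sum_subset; rewrite ?filter_uniq// => x.
  by rewrite mem_filter => /andP[].
have h2 : \sum_(x <- M l | x \notin X) z x l < e / 2.
  rewrite -big_filter; apply: le_lt_trans (hX [seq x <- M l | x \notin X] _ _).
  - rewrite big_seq [leRHS]big_seq; apply: ler_sum => x; rewrite mem_filter => /andP[_].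
    by move=> /z_le /andP[].
  - exact: filter_uniq.
  - by move=> x; rewrite mem_filter => /andP[].
lra.
Qed.

End Selection.
End Summation.

(** Enclosing [s] in a finite cube turns the sum into a product of [N] geometric sums, each at most
    2. *)
Lemma sum_half_powers (R : realType) (N : nat) (s : seq (mindex N)) : uniq s ->
  \sum_(i <- s) \prod_n 2^-1 ^+ i n <= 2 ^+ N :> R.
Proof.
move=> us; pose L := (\sum_(i <- s) \sum_n i n).+1.
pose f (g : {ffun 'I_N -> 'I_L}) : mindex N := [ffun n => nat_of_ord (g n)].
pose F (i : mindex N) : R := \prod_n 2^-1 ^+ i n.
have F0 i : 0 <= F i by apply: prodr_ge0 => n _; rewrite exprn_ge0.
have finj : injective f.
  by move=> g h /ffunP e; apply/ffunP => n; apply: val_inj; have := e n; rewrite !ffunE.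
have sf i : i \in s -> exists g, f g = i.
  move=> si; exists [ffun n => inord (i n)]; apply/ffunP => n; rewrite !ffunE inordK//.
  rewrite ltnS /L (bigD1_seq i)//= (bigD1 n)//=; lia.
pose t := [seq f g | g <- enum {ffun 'I_N -> 'I_L}].
apply: (@le_trans _ _ (\sum_(i <- t) F i)).
  apply: ler_sum_subset => //; first by rewrite map_inj_uniq ?enum_uniq.
  by move=> i /sf[g <-]; rewrite map_f// mem_enum.
rewrite big_map big_enum/=.
have -> : \sum_(g : {ffun 'I_N -> 'I_L}) F (f g) =
    \sum_(g : {ffun 'I_N -> 'I_L}) \prod_n 2^-1 ^+ g n.
  by apply: eq_bigr => g _; apply: eq_bigr => n _; rewrite ffunE.
rewrite -(bigA_distr_bigA (fun n (k : 'I_L) => 2^-1 ^+ k : R)) prodr_const card_ord.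
rewrite lerXn2r ?nnegrE//; first by rewrite sumr_ge0// => k _; rewrite exprn_ge0.
have h m : \sum_(k < m) 2^-1 ^+ k = 2 - 2 * 2^-1 ^+ m :> R.
  elim: m => [|m IH]; first by rewrite big_ord0 expr0; ring.
  by rewrite big_ord_recr/= IH exprS; field.
by rewrite h lerBlDr lerDl mulr_ge0// exprn_ge0.
Qed.

(** * Lebesgue measure and square-integrable functions *)

(** [f] may identify points, as when different boxes are cut to the same box; a section of [f] puts
    the image in bijection with a subset of [F]. *)
Lemma esum_image_le (R : realType) (T T' : choiceType) (F : set T) (f : T -> T')
    (a : T' -> \bar R) : (forall y, (0 <= a y)%E) ->
  (\esum_(y in f @` F) a y <= \esum_(x in F) a (f x))%E.
Proof.
move=> a0.
have [g gP] : {g : T' -> option T & forall y, (f @` F) y ->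
    exists x, [/\ g y = Some x, F x & f x = y]}.
  apply: (@choice _ _ (fun y o => (f @` F) y -> exists x, [/\ o = Some x, F x & f x = y])) => y.
  have [[x Fx xy]|n] := pselect ((f @` F) y); first by exists (Some x) => _; exists x.
  by exists None.
pose F' := [set x | exists2 y, (f @` F) y & g y = Some x].
have F'F : F' `<=` F.
  by move=> x [y Fy gy]; have [x' [+ Fx' _]] := gP y Fy; rewrite gy => -[->].
have bij : set_bij F' (f @` F) f.
  split.
  - by move=> x /F'F Fx; exists x.
  - move=> x x' /set_mem[y Fy gy] /set_mem[y' Fy' gy'] e.
    have [x1 [+ _ x1y]] := gP y Fy; rewrite gy => -[xx1].
    have [x2 [+ _ x2y]] := gP y' Fy'; rewrite gy' => -[xx2].
    have yy : y = y' by rewrite -x1y -x2y -xx1 -xx2.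
    by move: gy gy'; rewrite yy => -> [].
  - by move=> y Fy; have [x [gy Fx xy]] := gP y Fy; exists x => //; exists y.
rewrite (reindex_esum _ _ _ _ bij) esum_mkcond [leRHS]esum_mkcond; apply: le_esum => x _.
case: ifPn => [/set_mem/F'F Fx|_]; first by rewrite mem_set.
by case: ifPn.
Qed.

(** * Measurability of half-spaces and open sets *)

Section HalfSpaces.
Context (R : realType) (d : nat).
Implicit Types (q : 'rV[R]_d * 'rV[R]_d) (i : 'I_d) (c : R).

(** Lowers the upper corner, which leaves the part with [x_i <= c]; [cut_lo] leaves the part above.
    If a part is empty, the corners cross and the volume is 0. *)
Let cut_hi i c q := (q.1, subst_coord q.2 i (Num.min (q.2 0 i) c)).
Let cut_lo i c q := (subst_coord q.1 i (Num.max (q.1 0 i) c), q.2).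

Let cut_volume i c q :
  (box_volume (cut_hi i c q) + box_volume (cut_lo i c q) = box_volume q)%E.
Proof.
rewrite /box_volume /= -EFinD; congr (_%:E).
rewrite (bigD1 i)//= [X in _ + X](bigD1 i)//= [RHS](bigD1 i)//= !mxE eqxx.
have e1 : \prod_(k < d | k != i) Num.max 0 ((cut_hi i c q).2 0 k - q.1 0 k) =
    \prod_(k < d | k != i) Num.max 0 (q.2 0 k - q.1 0 k).
  by apply: eq_bigr => k ki; rewrite mxE (negbTE ki).
have e2 : \prod_(k < d | k != i) Num.max 0 (q.2 0 k - (cut_lo i c q).1 0 k) =
    \prod_(k < d | k != i) Num.max 0 (q.2 0 k - q.1 0 k).
  by apply: eq_bigr => k ki; rewrite mxE (negbTE ki).
rewrite /= in e1 e2; rewrite e1 e2 -mulrDl; congr (_ * _).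
move: (q.1 0 i) (q.2 0 i) => a b.
have [bc|cb] := leP b c; have [ac|ca] := leP a c; rewrite !maxEle.
all: by do ! (case: leP => ?); lra.
Qed.

(** Caratheodory's criterion: cutting every box of a cover along the hyperplane gives covers of both
    parts, and the volumes add up. *)
Lemma measurable_halfspace i c : measurable ([set x | x 0 i <= c] : set (Rd R d)).
Proof.
apply: le_caratheodory_measurable => X; apply: le_ereal_inf_tmp => _ [F [cF XF] <-].
have -> : (\esum_(q in F) box_volume q = \esum_(q in F) box_volume (cut_hi i c q) +
    \esum_(q in F) box_volume (cut_lo i c q))%E.
  rewrite -esumD; try by move=> q _; exact: box_volume_ge0.
  by apply: eq_esum => q _; rewrite cut_volume.
apply: leeD.
  apply: le_trans (esum_image_le _ _ _); last exact: box_volume_ge0.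
  apply: ereal_inf_lbound; exists (cut_hi i c @` F) => //; split.
    exact: (sub_countable (card_image_le _ _) cF).
  move=> x [Xx xc]; have [q Fq xq] := XF x Xx; exists (cut_hi i c q); first by exists q.
  move=> k /=; rewrite mxE; have /andP[xk1 xk2] := xq k; rewrite xk1.
  by case: eqP => [->|_]//; rewrite le_min -[in x 0 i <= _]/(x 0 i) xc andbT; case/andP: (xq i).
apply: le_trans (esum_image_le _ _ _); last exact: box_volume_ge0.
apply: ereal_inf_lbound; exists (cut_lo i c @` F) => //; split.
  exact: (sub_countable (card_image_le _ _) cF).
move=> x [Xx /negP]; rewrite -ltNge => xc.
have [q Fq xq] := XF x Xx; exists (cut_lo i c q); first by exists q.
move=> k /=; rewrite mxE; have /andP[xk1 xk2] := xq k; rewrite xk2 andbT.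
by case: eqP => [ki|_]//; rewrite ge_max -ki xk1 ki ltW.
Qed.

End HalfSpaces.

Lemma measurable_open (R : realType) (d : nat) (D : set 'rV[R]_d) :
  open D -> measurable (D : set (Rd R d)).
Proof.
move=> oD.
(* Half-open boxes are finite intersections of half-spaces and complements of half-spaces; rational
   corners make them countable. *)
pose hbox (q : 'rV[rat]_d * 'rV[rat]_d) : set (Rd R d) :=
  [set x | forall i, ratr (q.1 0 i) < x 0 i <= ratr (q.2 0 i)].
have mbox q : measurable (hbox q).
  have -> : hbox q = \bigcap_(i in [set: 'I_d])
      (~` [set x : Rd R d | x 0 i <= ratr (q.1 0 i)] `&`
       [set x : Rd R d | x 0 i <= ratr (q.2 0 i)]).
    apply/seteqP; split => [x qx i _ /=|x qx i]; last first.
      have [/= /negP + ->] := qx i Logic.I.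
      by rewrite -ltNge => ->.
    by have /andP[h ->] := qx i; split=> //; apply/negP; rewrite -ltNge.
  apply: fin_bigcap_measurable => [|i _]; first exact: finite_finset.
  apply: measurableI; last exact: measurable_halfspace.
  by apply: measurableC; exact: measurable_halfspace.
have -> : D = \bigcup_q (if `[< hbox q `<=` D >] then hbox q else set0).
  apply/seteqP; split => [x Dx|x [q _]]; last by case: asboolP => // + qx; exact.
  have /nbhs_ballP[e /= e0 eD] : nbhs x D by move: oD; rewrite openE => /(_ _ Dx).
  have h1 i : exists q : rat, ratr q \in `]x 0 i - e, x 0 i[%R by apply: rat_in_itvoo; lra.
  have h2 i : exists q : rat, ratr q \in `]x 0 i, x 0 i + e[%R by apply: rat_in_itvoo; lra.
  have [q1 q1P] := choice h1; have [q2 q2P] := choice h2.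
  exists (\row_i q1 i, \row_i q2 i) => //.
  rewrite asboolT => [|y /= qy].
    move=> i /=; rewrite !mxE; have := q1P i; have := q2P i; rewrite !in_itv/=.
    by move=> /andP[/ltW -> _] /andP[_ ->].
  apply: eD; split=> // i j; rewrite (ord1 i); have := qy j; rewrite /= !mxE.
  have := q1P j; have := q2P j; rewrite !in_itv/= => /andP[a1 a2] /andP[b1 b2] /andP[c1 c2].
  rewrite /ball/= ltr_norml; apply/andP; split; lra.
apply: (@countable_bigcupT_measurable _ (Rd R d)); first exact: countableP.
by move=> q; case: ifP => _; [exact: mbox|exact: measurable0].
Qed.

(** * Square-integrable functions and vector fields *)

Section SquareIntegrable.
Context (R : realType) (d : nat) (D : set 'rV[R]_d).
Hypothesis mD : measurable (D : set (Rd R d)).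
Implicit Types (v w b : 'rV[R]_d -> R) (g h : 'rV[R]_d -> 'rV[R]_d).
Local Notation mu := (leb R d).
Local Open Scope ereal_scope.

Lemma L2normE w : L2norm D w = (\int[mu]_(x in D) (w x ^+ 2)%:E) `^ 2^-1.
Proof.
rewrite /L2norm Lnorm.unlock; congr (_ `^ _); rewrite [RHS]integral_mkcond.
apply: eq_integral => x _; rewrite /comp !patchE.
case: ifPn => _ /=; first by rewrite powR_mulrn ?normr_ge0// real_normK ?num_real.
(* Outside [D] the restrictions take the default value [point], which is 0. *)
have -> : point = 0%R :> R by [].
have -> : point = 0%E :> \bar R by [].
by rewrite normr0 powR0// pnatr_eq0.
Qed.

Lemma measurable_sqr w : lmeasurable_fun D w ->
  @measurable_fun _ _ (Rd R d) _ D (fun x => (w x ^+ 2)%:E).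
Proof. by move=> mw; apply/measurable_EFinP; exact: measurable_funX. Qed.

Lemma L2_integrable_sqr w : L2 D w -> mu.-integrable D (fun x => (w x ^+ 2)%:E).
Proof.
move=> [mw wfin]; apply/integrableP; split; first exact: measurable_sqr.
under eq_integral do rewrite gee0_abs ?lee_fin ?sqr_ge0//.
by move: wfin; rewrite L2normE; apply: lty_poweRy; rewrite invr_eq0.
Qed.

Lemma integrable_sqr_L2 w : lmeasurable_fun D w ->
  mu.-integrable D (fun x => (w x ^+ 2)%:E) -> L2 D w.
Proof.
move=> mw /integrableP[_]; under eq_integral do rewrite gee0_abs ?lee_fin ?sqr_ge0//.
by move=> wfin; split=> //; rewrite L2normE; exact: poweR_lty.
Qed.

Lemma L2_integrable_mul v w : L2 D v -> L2 D w ->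
  mu.-integrable D (EFin \o (fun x => (v x * w x)%R)).
Proof.
move=> Lv Lw; have iv := L2_integrable_sqr Lv; have iw := L2_integrable_sqr Lw.
apply: le_integrable (integrableD mD iv iw) => //.
  by apply/measurable_EFinP; apply: measurable_funM; [exact: Lv.1|exact: Lw.1].
move=> x _ /=; rewrite lee_fin [leRHS]ger0_norm ?addr_ge0 ?sqr_ge0// ler_norml.
have := sqr_ge0 (v x - w x); have := sqr_ge0 (v x + w x); rewrite sqrrD sqrrB.
have := sqr_ge0 (v x); have := sqr_ge0 (w x).
by move=> *; apply/andP; split; lra.
Qed.

Lemma L2_lin a v w : L2 D v -> L2 D w -> L2 D (fun x => a * v x + w x)%R.
Proof.
move=> Lv Lw; have mvw : lmeasurable_fun D (fun x => a * v x + w x)%R.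
  by apply: measurable_funD; [apply: measurable_funM => //; exact: Lv.1|exact: Lw.1].
apply: integrable_sqr_L2 => //.
have iv := integrableZl mD (2 * a ^+ 2) (L2_integrable_sqr Lv).
have iw := integrableZl mD 2 (L2_integrable_sqr Lw).
apply: le_integrable (integrableD mD iv iw) => //; first exact: measurable_sqr.
move=> x _ /=; rewrite lee_fin [leLHS]ger0_norm ?sqr_ge0//; apply: le_trans (ler_norm _).
have := sqr_ge0 (a * v x - w x); rewrite sqrrB sqrrD exprMn.
lra.
Qed.

Lemma L2_bounded_mul b v K : lmeasurable_fun D b -> (forall x, D x -> (`|b x| <= K)%R) ->
  L2 D v -> L2 D (fun x => b x * v x)%R.
Proof.
move=> mb bK Lv; have mbv : lmeasurable_fun D (fun x => b x * v x)%R.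
  by apply: measurable_funM => //; exact: Lv.1.
apply: integrable_sqr_L2 => //.
apply: le_integrable (integrableZl mD (K ^+ 2) (L2_integrable_sqr Lv)) => //.
  exact: measurable_sqr.
move=> x Dx /=; rewrite lee_fin [leLHS]ger0_norm ?sqr_ge0//; apply: le_trans (ler_norm _).
rewrite exprMn ler_wpM2r ?sqr_ge0//.
rewrite -[leLHS]real_normK ?num_real// ler_pXn2r// ?nnegrE// ?(le_trans _ (bK x Dx))//.
Qed.

End SquareIntegrable.

Section DotProduct.
Context (R : realType) (d : nat).
Implicit Types (x y z : 'rV[R]_d).

Lemma dotvC x y : dotv x y = dotv y x.
Proof. by apply: eq_bigr => i _; rewrite mulrC. Qed.

Lemma dotv_lin a x y z : dotv (a *: x + y) z = a * dotv x z + dotv y z.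
Proof.
rewrite /dotv mulr_sumr -big_split; apply: eq_bigr => i _ /=.
by rewrite !mxE mulrDl mulrA.
Qed.

Lemma dotvZl a x z : dotv (a *: x) z = a * dotv x z.
Proof. by rewrite /dotv mulr_sumr; apply: eq_bigr => i _; rewrite mxE mulrA. Qed.

Lemma dotv_ge0 x : 0 <= dotv x x.
Proof. by apply: sumr_ge0 => i _; rewrite -expr2 sqr_ge0. Qed.

Definition mulfun (b : 'rV[R]_d -> R) (g : 'rV[R]_d -> 'rV[R]_d) : 'rV[R]_d -> 'rV[R]_d :=
  fun x => b x *: g x.

Lemma mulfun_is_linear b : linear (mulfun b).
Proof.
move=> a g h; apply/funext => x; transitivity (b x *: (a *: g x + h x)) => //.
transitivity (a *: (b x *: g x) + b x *: h x) => //.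
by rewrite scalerDr !scalerA mulrC.
Qed.

HB.instance Definition _ b := GRing.isLinear.Build R ('rV[R]_d -> 'rV[R]_d)
  ('rV[R]_d -> 'rV[R]_d) *:%R (mulfun b) (mulfun_is_linear b).

End DotProduct.

Section VectorL2.
Context (R : realType) (d : nat) (D : set 'rV[R]_d).
Hypothesis mD : measurable (D : set (Rd R d)).
Implicit Types (b : 'rV[R]_d -> R) (g h k : 'rV[R]_d -> 'rV[R]_d).
Local Notation mu := (leb R d).

Definition ip_L2 g h : R := \int[mu]_(x in D) dotv (g x) (h x).

Lemma integrable_dotv g h : L2v D g -> L2v D h ->
  mu.-integrable D (EFin \o (fun x => dotv (g x) (h x))).
Proof.
move=> Lg Lh.
have := integrable_sum (mu := mu) mD (index_enum 'I_d) (P := xpredT)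
  (h := fun i x => (g x 0 i * h x 0 i)%:E) => H.
have := H (fun i _ => L2_integrable_mul mD (Lg i) (Lh i)).
by congr (mu.-integrable _ _); apply/funext => x; rewrite /dotv /= sumEFin.
Qed.

Lemma L2v0 : L2v D 0.
Proof.
move=> j; have -> : (fun x => (0 : 'rV[R]_d -> 'rV[R]_d) x 0 j) = fun=> 0.
  by apply/funext => x; rewrite mxE.
apply: integrable_sqr_L2; first exact: measurable_cst.
have e : cst 0%E = (fun=> ((0 : R) ^+ 2)%:E) :> (Rd R d -> \bar R).
  by apply/funext => x; rewrite expr0n.
by move: (integrable0 (leb R d) D); rewrite e.
Qed.

Lemma L2v_lin a g h : L2v D g -> L2v D h -> L2v D (a *: g + h).
Proof.
move=> Lg Lh j; have := L2_lin mD a (Lg j) (Lh j).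
by congr (L2 D _); apply/funext => x; rewrite !mxE.
Qed.

Lemma L2v_mulfun b K g : lmeasurable_fun D b -> (forall x, D x -> `|b x| <= K) ->
  L2v D g -> L2v D (mulfun b g).
Proof.
move=> mb bK Lg j; have := L2_bounded_mul mD mb bK (Lg j).
by congr (L2 D _); apply/funext => x; rewrite /mulfun mxE.
Qed.

Lemma ip_L2C g h : ip_L2 g h = ip_L2 h g.
Proof. by apply: eq_Rintegral => x _; exact: dotvC. Qed.

Lemma ip_L2_lin a g h k : L2v D g -> L2v D h -> L2v D k ->
  ip_L2 (a *: g + h) k = a * ip_L2 g k + ip_L2 h k.
Proof.
move=> Lg Lh Lk; have ig := integrable_dotv Lg Lk; have ih := integrable_dotv Lh Lk.
rewrite /ip_L2 -(RintegralZl a mD ig) -RintegralD//.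
  by apply: eq_Rintegral => x _; rewrite -dotv_lin.
exact: (integrableZl mD a ig).
Qed.

Lemma ip_L2_ge0 g : 0 <= ip_L2 g g.
Proof. by apply: Rintegral_ge0 => x _; exact: dotv_ge0. Qed.

Lemma ip_L2_mulfun b g h : ip_L2 (mulfun b g) h = ip_L2 g (mulfun b h).
Proof.
by apply: eq_Rintegral => x _; rewrite /mulfun dotvZl [RHS]dotvC dotvZl (dotvC (h x)).
Qed.

Lemma ip_L2_le g h g' h' : L2v D g -> L2v D h -> L2v D g' -> L2v D h' ->
  (forall x, D x -> dotv (g x) (h x) <= dotv (g' x) (h' x)) -> ip_L2 g h <= ip_L2 g' h'.
Proof. by move=> ? ? ? ? H; apply: le_Rintegral => //; exact: integrable_dotv. Qed.

Lemma ip_L2Z a g h : L2v D g -> L2v D h -> ip_L2 (a *: g) h = a * ip_L2 g h.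
Proof.
move=> Lg Lh; rewrite /ip_L2 -(RintegralZl a mD (integrable_dotv Lg Lh)).
by apply: eq_Rintegral => x _; rewrite -dotvZl.
Qed.

Lemma ip_L2_mulfun_bounds b lb ub g : lmeasurable_fun D b ->
  (forall x, D x -> lb <= b x <= ub) -> L2v D g ->
  lb * ip_L2 g g <= ip_L2 (mulfun b g) g <= ub * ip_L2 g g.
Proof.
move=> mb bb Lg.
have bK x : D x -> `|b x| <= `|lb| + `|ub|.
  move=> /bb /andP[h1 h2]; rewrite ler_norml; apply/andP; split.
    have := ler_norm (- lb); rewrite normrN; have := normr_ge0 ub; lra.
  have := ler_norm ub; have := normr_ge0 lb; lra.
have Lbg := L2v_mulfun mb bK Lg.
have LZ a : L2v D (a *: g) by rewrite -[_ *: _]addr0; apply: L2v_lin => //; exact: L2v0.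
rewrite -!ip_L2Z//; apply/andP; split; apply: ip_L2_le => // x /bb /andP[h1 h2];
  by rewrite !dotvZl ler_wpM2r// dotv_ge0.
Qed.

Lemma ip_L2_mulfun_le b K g : lmeasurable_fun D b -> (forall x, D x -> `|b x| <= K) ->
  L2v D g -> ip_L2 (mulfun b g) (mulfun b g) <= K ^+ 2 * ip_L2 g g.
Proof.
move=> mb bK Lg; have Lbg := L2v_mulfun mb bK Lg.
have LZ a : L2v D (a *: g) by rewrite -[_ *: _]addr0; apply: L2v_lin => //; exact: L2v0.
rewrite -ip_L2Z//; apply: ip_L2_le => // x Dx.
rewrite /mulfun !dotvZl (dotvC (g x)) dotvZl mulrA -expr2 ler_wpM2r ?dotv_ge0//.
have K0 : 0 <= K by apply: le_trans (bK x Dx).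
by rewrite -[leLHS]real_normK ?num_real// ler_pXn2r// ?nnegrE// bK.
Qed.

Lemma L2normvE g : L2v D g -> L2normv D g = (nrm ip_L2 g)%:E.
Proof.
move=> Lg; rewrite /L2normv L2normE.
have -> : (\int[mu]_(x in D) (((@norm2 R d \o g) x) ^+ 2)%:E = (ip_L2 g g)%:E)%E.
  rewrite /ip_L2 /Rintegral fineK; last first.
    exact: (integrable_fin_num mD (integrable_dotv Lg Lg)).
  by apply: eq_integral => x _; rewrite /= /norm2 sqr_sqrtr// dotv_ge0.
by rewrite poweR_EFin powR12_sqrt// ip_L2_ge0.
Qed.

Lemma L2normv_ge0 g : (0 <= L2normv D g)%E.
Proof. by rewrite /L2normv L2normE poweR_ge0. Qed.

End VectorL2.

(** * Convergence of the adaptive algorithm *)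

Section FiniteSetSeq.
Context (T : choiceType).
Implicit Type A : set T.

Definition set_seq A : seq T := finmap.enum_fset (fset_set A).

Lemma set_seq_uniq A : uniq (set_seq A).
Proof. exact: finmap.fset_uniq. Qed.

Lemma mem_set_seq A x : finite_set A -> (x \in set_seq A) = (x \in A).
Proof. by move=> fA; exact: (in_fset_set fA x). Qed.

Lemma set_seqP A x : finite_set A -> x \in set_seq A <-> A x.
Proof. by move=> fA; rewrite mem_set_seq// inE. Qed.

End FiniteSetSeq.

Lemma work_ge1 (R : realType) N (j : mindex N) : positive j -> 1 <= work R j.
Proof.
move=> j0; rewrite /work -natr_prod ler1n prodn_gt0// => n.
by rewrite subn_gt0; have := j0 n; case: (j n) => // m _; exact: level_lt.
Qed.

Section Convergence.
Context (R : realType) (d N : nat) (D : set 'rV[R]_d) (lo hi : 'I_N -> R) (f : 'rV[R]_d -> R)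
  (a0 : 'rV[R]_d -> R) (an : 'I_N -> 'rV[R]_d -> R) (amin amax : R)
  (u : 'rV[R]_N -> sobolev R d).
Hypotheses (N1 : (1 <= N)%N) (oD : open D) (D0 : D !=set0).
Hypothesis lohi : forall n, lo n < hi n.
Hypotheses (ma0 : lmeasurable_fun D a0) (man : forall n, lmeasurable_fun D (an n)).
Hypothesis amin0 : 0 < amin.
Hypothesis coefb : forall y x, Gam lo hi y -> D x -> amin <= coef a0 an y x <= amax.
Hypothesis solu : parametric_solution D (Gam lo hi) (coef a0 an) f u.

Implicit Types (y p : 'rV[R]_N) (I : set (mindex N)) (i j : mindex N).
Local Notation Gam := (Gam lo hi).
Local Notation zeta := (zeta D lo hi (coef a0 an) u).

Let y0 : 'rV[R]_N := \row_n lo n.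

Let Gy0 : Gam y0.
Proof. by move=> n; rewrite mxE lexx ltW. Qed.

Let mD : measurable (D : set (Rd R d)). Proof. exact: measurable_open. Qed.

Lemma amin_le_amax : amin <= amax.
Proof. by have [x Dx] := D0; have /andP[] := coefb Gy0 Dx; exact: le_trans. Qed.

(** The coefficient bounds at the two ends of the [n]-th interval, with the other coordinates fixed,
    isolate [an n]. *)
Lemma an_bounded n x : D x -> `|an n x| <= (amax - amin) / (hi n - lo n).
Proof.
move=> Dx; pose y1 := subst_coord y0 n (hi n).
have Gy1 : Gam y1 by apply: Gam_subst_coord => //; rewrite lexx andbT ltW.
have h0 : 0 < hi n - lo n by rewrite subr_gt0.
have e : coef a0 an y1 x - coef a0 an y0 x = an n x * (hi n - lo n).
  rewrite /coef opprD addrACA subrr add0r -sumrB (bigD1 n)//= big1 ?addr0.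
    by rewrite subst_coord_same mxE mulrBr.
  by move=> k kn; rewrite subst_coord_other// subrr.
rewrite ler_pdivlMr// -(gtr0_norm h0) -normrM -e.
have /andP[c1 c2] := coefb Gy0 Dx; have /andP[c3 c4] := coefb Gy1 Dx.
by rewrite ler_norml; apply/andP; split; lra.
Qed.

Let KA : R := \sum_n (amax - amin) / (hi n - lo n).

Let an_le n x : D x -> `|an n x| <= KA.
Proof.
move=> Dx; apply: (le_trans (an_bounded n Dx)); rewrite /KA (bigD1 n)//= lerDl.
by apply: sumr_ge0 => k _; rewrite divr_ge0 ?subr_ge0 ?amin_le_amax// ltW.
Qed.

Let KA0 : 0 <= KA.
Proof. by apply: sumr_ge0 => k _; rewrite divr_ge0 ?subr_ge0 ?amin_le_amax// ltW. Qed.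

Lemma a0_bounded : exists K, forall x, D x -> `|a0 x| <= K.
Proof.
exists (amax + KA * \sum_n `|lo n|) => x Dx.
have -> : a0 x = coef a0 an y0 x - \sum_n an n x * lo n.
  rewrite /coef; under [in X in _ = _ + X - _]eq_bigr do rewrite mxE.
  by rewrite addrK.
have /andP[c1 c2] := coefb Gy0 Dx.
apply: (le_trans (ler_normB _ _)); rewrite lerD//.
  by rewrite ger0_norm// (le_trans (ltW amin0)).
apply: (le_trans (ler_norm_sum _ _ _)); rewrite mulr_sumr; apply: ler_sum => n _.
by rewrite normrM ler_wpM2r// an_le.
Qed.

Lemma measurable_coef y : lmeasurable_fun D (coef a0 an y).
Proof.
apply: measurable_funD => //; apply: measurable_sum => n.
by apply: measurable_funM; [exact: man|exact: measurable_cst].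
Qed.

Let A0 : {linear ('rV[R]_d -> 'rV[R]_d) -> ('rV[R]_d -> 'rV[R]_d)} := mulfun a0.
Let A (n : 'I_N) : {linear ('rV[R]_d -> 'rV[R]_d) -> ('rV[R]_d -> 'rV[R]_d)} := mulfun (an n).
Let U y : 'rV[R]_d -> 'rV[R]_d := (u y).2.
Let Phi p : R := fine (\int[leb R d]_(x in D) (f x * (u p).1 x)%:E)%E.

Lemma energy_opE y g : energy_op A0 A y g = mulfun (coef a0 an y) g.
Proof.
apply/funext => x; transitivity (a0 x *: g x + (\sum_n y 0 n *: A n g) x) => //.
rewrite fct_sumE /mulfun /coef scalerDl scaler_suml; congr (_ + _).
by apply: eq_bigr => n _; rewrite [LHS]scalerA mulrC.
Qed.

Let W0 : L2v D 0 := L2v0 D.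
Let WZD a x z : L2v D x -> L2v D z -> L2v D (a *: x + z). Proof. exact: L2v_lin. Qed.
Let WA0 x : L2v D x -> L2v D (A0 x).
Proof. by have [K a0K] := a0_bounded; exact: L2v_mulfun a0K. Qed.
Let WA n x : L2v D x -> L2v D (A n x).
Proof. by apply: L2v_mulfun => //; exact: an_le. Qed.
Let ellip y x : Gam y -> L2v D x ->
  amin * ip_L2 D x x <= ip_L2 D (energy_op A0 A y x) x <= amax * ip_L2 D x x.
Proof.
move=> Gy Wx; rewrite energy_opE; apply: ip_L2_mulfun_bounds => //; first exact: measurable_coef.
by move=> z; exact: coefb.
Qed.
Let A_le n x : L2v D x -> ip_L2 D (A n x) (A n x) <= KA ^+ 2 * ip_L2 D x x.
Proof. by move=> Wx; apply: ip_L2_mulfun_le => //; exact: an_le. Qed.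
Let Wu y : Gam y -> L2v D (U y). Proof. by move=> /solu[[]]. Qed.
Let solves y p : Gam y -> Gam p -> ip_L2 D (energy_op A0 A y (U y)) (U p) = Phi p.
Proof.
move=> Gy Gp; have [_ /(_ _ (solu Gp).1) e] := solu Gy; rewrite /Phi -e energy_opE.
by congr fine; apply: eq_integral => x _; rewrite /mulfun dotvZl.
Qed.

Let A0_sym x z : L2v D x -> L2v D z -> ip_L2 D (A0 x) z = ip_L2 D x (A0 z).
Proof. by move=> _ _; exact: ip_L2_mulfun. Qed.
Let A_sym n x z : L2v D x -> L2v D z -> ip_L2 D (A n x) z = ip_L2 D x (A n z).
Proof. by move=> _ _; exact: ip_L2_mulfun. Qed.

Let flux s := flux_on lo hi (A0 \o U) (fun n => A n \o U) s.

Lemma snd_eval (r : seq (R * 'rV[R]_N)) (v : 'rV[R]_N -> sobolev R d) :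
  (eval r v).2 = eval r (fun y => (v y).2).
Proof. by rewrite /eval; elim/big_rec2 : _ => // q x z _ <-. Qed.

Lemma snd_S_u I y : finite_set I -> Gam y -> (S_u lo hi u I y).2 = Ssum lo hi (set_seq I) U y.
Proof.
move=> Ifin Gy; rewrite /S_u /S_interp fsbig_finite// /Ssum fct_sumE -/(set_seq I).
elim: (set_seq I) => [|i s IH]; first by rewrite !big_nil.
rewrite !big_cons -IH /=; congr (_ + _).
by have [r [_ _ rE]] := samples_Delta lohi i Gy; rewrite !rE snd_eval.
Qed.

(** The two fluxes are compared on [Gam] only, which suffices because [Delta] samples only there. *)
Lemma Delta_flux I i y : finite_set I -> Gam y ->
  Delta lo hi i (Defs.flux lo hi (coef a0 an) u I) y = Delta lo hi i (flux (set_seq I)) y.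
Proof.
move=> Ifin Gy; have [r [rG _ rE]] := samples_Delta lohi i Gy; rewrite !rE.
rewrite /eval big_seq [RHS]big_seq; apply: eq_bigr => q /rG Gq; congr (_ *: _).
rewrite /flux (flux_on_energy_op A0 A U lohi)// energy_opE /Defs.flux /mulfun.
by rewrite snd_S_u.
Qed.

Let WDelta I i y : Gam y -> L2v D (Delta lo hi i (flux (set_seq I)) y).
Proof.
move=> Gy; apply: (W_Delta lohi W0 WZD _ Gy) => p Gp.
rewrite /flux (flux_on_energy_op A0 A U lohi)//; apply: (W_energy_op W0 WZD WA0 WA).
rewrite /Ssum fct_sumE; apply: (W_sum W0 WZD) => j _ _.
exact: (W_Delta lohi W0 WZD _ Gp Wu).
Qed.

Lemma zeta_ge0 i I : (0 <= zeta i I)%E.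
Proof.
apply: (le_trans (L2normv_ge0 D (Delta lo hi i (Defs.flux lo hi (coef a0 an) u I) y0))).
by apply: ereal_sup_ubound; exists y0.
Qed.

Lemma nrm_le_zeta i I y : finite_set I -> Gam y ->
  ((nrm (ip_L2 D) (Delta lo hi i (flux (set_seq I)) y))%:E <= zeta i I)%E.
Proof.
move=> Ifin Gy; apply: ereal_sup_ubound; exists y => //.
by rewrite Delta_flux// L2normvE//; exact: WDelta.
Qed.

Lemma zeta_bound : exists2 C, 0 <= C & forall I i, admissible I -> margin I i ->
  (zeta i I <= (C * \prod_n 2^-1 ^+ i n)%:E)%E.
Proof.
have [C C0 h] := flux_bound lohi W0 WZD (@ip_L2C _ _ D) (ip_L2_lin mD)
  (fun x _ => ip_L2_ge0 D x) WA0 WA A0_sym A_sym amin0 amin_le_amax KA0 ellip A_le Wu solves N1.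
exists C => // I i [Ifin Idc Ipos I1] [i0 Ii _]; apply: ge_ereal_sup => _ [y Gy <-].
rewrite Delta_flux// L2normvE//; last exact: WDelta.
rewrite lee_fin; apply: h => //; first exact: set_seq_uniq.
  by move=> j; rewrite set_seqP// => /Ipos.
by apply/negP; rewrite set_seqP.
Qed.

Let zr i I := fine (zeta i I).

Lemma zetaE i I : admissible I -> margin I i -> zeta i I = (zr i I)%:E.
Proof.
move=> aI Mi; have [C _ /(_ I i aI Mi) h] := zeta_bound.
rewrite fineK// ge0_fin_numE ?zeta_ge0//; apply: le_lt_trans h _; exact: ltry.
Qed.

Lemma zr_ge0 i I : 0 <= zr i I. Proof. by rewrite fine_ge0// zeta_ge0. Qed.

Lemma sum_zetaE (B : set (mindex N)) I : admissible I -> B `<=` margin I ->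
  (\sum_(i \in B) zeta i I)%E = (\sum_(i <- set_seq B) zr i I)%:E.
Proof.
move=> aI BM; have [Ifin _ _ _] := aI.
have Bfin : finite_set B by apply: sub_finite_set BM _; exact: finite_margin.
rewrite fsbig_finite// -sumEFin; apply: eq_big_seq => i iB.
by apply: zetaE => //; apply: BM; apply/set_seqP.
Qed.

Lemma error_le I : admissible I ->
  (error D lo hi u I <= (amin^-1 * \sum_(i <- set_seq (margin I)) zr i I)%:E)%E.
Proof.
move=> aI; have [Ifin Idc Ipos I1] := aI; have Mfin := finite_margin Ifin.
have mI j : j \in set_seq I <-> I j by exact: set_seqP.
have mM j : j \in set_seq (margin I) <-> margin I j by exact: set_seqP.
apply: ge_ereal_sup => _ [y Gy <-].
have WS : L2v D (Ssum lo hi (set_seq I) U y).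
  rewrite /Ssum fct_sumE; apply: (W_sum W0 WZD) => j _ _.
  exact: (W_Delta lohi W0 WZD _ Gy Wu).
rewrite /Vnorm (_ : (u y - _).2 = U y - Ssum lo hi (set_seq I) U y); last first.
  by rewrite -snd_S_u.
rewrite L2normvE//; last first.
  by rewrite addrC -scaleN1r; apply: WZD => //; exact: Wu.
rewrite lee_fin ler_pdivlMl//.
apply: le_trans (reliability lohi W0 WZD (@ip_L2C _ _ D) (ip_L2_lin mD)
  (fun x _ => ip_L2_ge0 D x) WA0 WA ellip Wu solves
  (t := set_seq (margin I)) _ _ _ _ _ Gy) _.
- rewrite cat_uniq !set_seq_uniq andbT; apply/hasPn => j /mM[_ + _].
  by move=> nIj; apply/negP => /mI.
- by move=> j; rewrite mem_cat => /orP[/mI/Ipos|/mM[]].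
- move=> j /mI Ij n; rewrite mem_cat; apply/orP.
  by have [/mI|/mM] := margin_incr n aI Ij; [left|right].
- by move=> j /mI Ij n jn; apply/mI; exact: Idc.
- exact/mI.
rewrite big_seq [leRHS]big_seq; apply: ler_sum => i /mM Mi.
by rewrite -lee_fin -zetaE//; exact: nrm_le_zeta.
Qed.

(** The work of everything below [j] bounds the work of the completion of [j] for every index
    set. *)
Let Wb j : R := \sum_(x <- set_seq [set x | le_mindex x j]) work R x.

Let work_ge0 (x : mindex N) : 0 <= work R x.
Proof. by apply: prodr_ge0 => n _; exact: ler0n. Qed.

(** With [S] the estimator sum and [w] the work of a completion, maximality gives
    [S j / w j <= S i / w i <= S i], as [w i >= 1], or [S j <= S i] without work. In both cases
    [zr j I <= S j <= w j * S i]. *)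
Lemma selection_bound (P : mindex N -> set (mindex N) -> \bar R) I i j :
  P = workless_profit D lo hi (coef a0 an) u \/ P = work_profit D lo hi (coef a0 an) u ->
  admissible I -> is_selected P I i -> margin I j ->
  zr j I <= Wb j * \sum_(x <- set_seq (completion I i)) zr x I.
Proof.
move=> hP aI [Mi sel] Mj; have [Ifin Idc Ipos I1] := aI.
have cM x : margin I x -> completion I x `<=` margin I.
  by move=> Mx; rewrite completionE//; exact: missing_margin.
have cfin x : margin I x -> finite_set (completion I x).
  by move=> Mx; rewrite completionE//; exact: finite_missing.
have cself x : margin I x -> x \in set_seq (completion I x).
  by move=> Mx; apply/set_seqP; [exact: cfin|exact: completion_self].
pose S x := \sum_(y <- set_seq (completion I x)) zr y I.
pose w x := \sum_(y <- set_seq (completion I x)) work R y.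
have wlE x : margin I x -> workless_profit D lo hi (coef a0 an) u x I = (S x)%:E.
  by move=> Mx; apply: sum_zetaE => //; exact: cM.
have wE x : margin I x -> work_profit D lo hi (coef a0 an) u x I = (S x / w x)%:E.
  by move=> Mx; rewrite /work_profit wlE// (fsbig_finite _ _ (cfin x Mx)) EFinM.
have S0 x : 0 <= S x by apply: sumr_ge0 => y _; exact: zr_ge0.
have w1 x : margin I x -> 1 <= w x.
  move=> Mx; apply: (@le_trans _ _ (work R x)); first by apply: work_ge1; case: Mx.
  by rewrite /w (bigD1_seq x) ?cself ?set_seq_uniq//= lerDl sumr_ge0.
have zS : zr j I <= S j.
  rewrite /S (bigD1_seq j) ?cself ?set_seq_uniq//= lerDl.
  by apply: sumr_ge0 => y _; exact: zr_ge0.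
have wWb : w j <= Wb j.
  apply: ler_sum_subset => //; rewrite ?set_seq_uniq// => y.
  rewrite set_seqP; last exact: cfin.
  by rewrite completionE// => -[_ yj _]; apply/set_seqP => //; exact: finite_le_mindex.
have Pji : (P j I <= P i I)%E.
  have [->//|/eqP ji] := eqVneq j i.
  by have [/ltW//|[-> _]] := sel j Mj ji.
apply: (le_trans zS); apply: (@le_trans _ _ (w j * S i)); last by rewrite ler_wpM2r.
have [wj wi] := (w1 j Mj, w1 i Mi).
case: hP => PE; move: Pji; rewrite PE ?wlE ?wE// lee_fin => h.
  by apply: (le_trans h); rewrite ler_peMl.
rewrite -ler_pdivrMl ?(lt_le_trans ltr01)// mulrC; apply: (le_trans h).
by rewrite ler_pdivrMr ?(lt_le_trans ltr01)// ler_peMr.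
Qed.

Section Sequence.
Context (P : mindex N -> set (mindex N) -> \bar R) (J : nat -> set (mindex N)).
Hypothesis hP : P = workless_profit D lo hi (coef a0 an) u \/
  P = work_profit D lo hi (coef a0 an) u.
Hypothesis SC : SC_sequence P J.

Lemma SC_admissible l : admissible (J l).
Proof.
have [J0 JS] := SC; elim: l => [|l IH]; first by rewrite J0; exact: admissible_ones.
by have [i [Mi _] ->] := JS l; exact: admissible_step.
Qed.

Lemma SC_mono l l' : (l <= l')%N -> J l `<=` J l'.
Proof.
have [_ JS] := SC; elim: l' => [|l' IH]; first by rewrite leqn0 => /eqP ->.
rewrite leq_eqVlt => /predU1P[->//|]; rewrite ltnS => /IH h x /h Jx.
by have [i _ ->] := JS l'; left.
Qed.

Let r l : R := \sum_(x <- set_seq (margin (J l))) zr x (J l).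

Lemma estimator_small e : 0 < e -> exists l0, forall l, (l0 <= l)%N -> 0 <= r l < e.
Proof.
have [_ JS] := SC.
have /choice[sel selP] : forall l, exists i, is_selected P (J l) i /\
    J l.+1 = J l `|` completion (J l) i.
  by move=> l; have [i si Ji] := JS l; exists i.
have [C C0 zC] := zeta_bound.
pose zb (i : mindex N) : R := C * \prod_n 2^-1 ^+ i n.
have Jdc l : down_closed (J l) by have [] := SC_admissible l.
have Mfin l : finite_set (margin (J l)) by have [? _ _ _] := SC_admissible l; exact: finite_margin.
have Msel l : margin (J l) (sel l) by have [[]] := selP l.
have cE l : completion (J l) (sel l) = missing (J l) (sel l) by exact: completionE.
have mA l x : x \in set_seq (completion (J l) (sel l)) <-> completion (J l) (sel l) x.
  by apply: set_seqP; rewrite cE; exact: finite_missing.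
have mM l x : x \in set_seq (margin (J l)) <-> margin (J l) x by exact: set_seqP.
apply: (@margin_sum_small _ _ zb (C * 2 ^+ N) _ (fun l => set_seq (margin (J l)))
  (fun l => set_seq (completion (J l) (sel l))) (fun x l => zr x (J l)) Wb).
- by move=> s us; rewrite -mulr_sumr ler_wpM2l// sum_half_powers.
- by move=> l; exact: set_seq_uniq.
- by move=> l; exact: set_seq_uniq.
- by move=> l x /mA; rewrite cE => cx; apply/mM; exact: missing_margin cx.
(* A selected index belongs to all later index sets, hence to no later completion. *)
- have lt_disj l l' x : (l < l')%N -> x \in set_seq (completion (J l) (sel l)) ->
      x \in set_seq (completion (J l') (sel l')) -> False.
    move=> ll' /mA xA /mA; rewrite cE => -[_ _]; apply; apply: (SC_mono ll').
    by have [_ ->] := selP l; right.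
  move=> x l l' xl xl'; have [ll'|l'l|//] := ltngtP l l'.
    by have := lt_disj _ _ _ ll' xl xl'.
  by have := lt_disj _ _ _ l'l xl' xl.
- move=> l x /mM Mx; rewrite zr_ge0/= -lee_fin -zetaE//; last exact: SC_admissible.
  by apply: zC => //; exact: SC_admissible.
- by move=> x; apply: sumr_ge0.
- move=> l x /mM Mx; apply: (selection_bound hP) => //; first exact: SC_admissible.
  by have [] := selP l.
Qed.

Lemma zeta_SC_r l : zeta_SC D lo hi (coef a0 an) u (J l) = (r l)%:E.
Proof. by apply: sum_zetaE => //; exact: SC_admissible. Qed.

Lemma r_cvg : r l @[l --> \oo] --> (0 : R).
Proof.
apply/cvgrPdist_lt => e e0; have [l0 h] := estimator_small e0.
by exists l0 => // l /= /h /andP[r0 re]; rewrite sub0r normrN ger0_norm.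
Qed.

Lemma SC_convergence :
  zeta_SC D lo hi (coef a0 an) u (J l) @[l --> \oo] --> 0%E /\
  error D lo hi u (J l) @[l --> \oo] --> 0%E.
Proof.
split.
  under eq_cvg do rewrite zeta_SC_r.
  by apply: cvg_EFin; [exact: nearW|exact: r_cvg].
apply: (@squeeze_cvge _ _ _ _ (fun=> 0%E) _ (fun l => (amin^-1 * r l)%:E)).
- apply: nearW => l; rewrite error_le ?andbT; last exact: SC_admissible.
  apply: (le_trans (L2normv_ge0 D ((u y0 - S_u lo hi u (J l) y0).2))).
  by apply: ereal_sup_ubound; exists y0.
- exact: cvg_cst.
- apply: cvg_EFin; first exact: nearW.
  rewrite -[X in _ --> X](mulr0 amin^-1).
  by apply: cvgM; [exact: cvg_cst|exact: r_cvg].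
Qed.

End Sequence.
End Convergence.

Theorem theorem2p15 (R : realType) (d N : nat) (D : set 'rV[R]_d)
    (lo hi : 'I_N -> R) (f : 'rV[R]_d -> R)
    (a0 : 'rV[R]_d -> R) (an : 'I_N -> 'rV[R]_d -> R) (amin amax : R)
    (Tinit : set (set 'rV[R]_d)) (u : 'rV[R]_N -> sobolev R d)
    (P : mindex N -> set (mindex N) -> \bar R)
    (I : nat -> set (mindex N)) :
  (2 <= d)%N -> (1 <= N)%N ->
  bounded_lipschitz_domain D ->
  (forall n, lo n < hi n) ->
  L2 D f ->
  lmeasurable_fun D a0 -> (forall n, lmeasurable_fun D (an n)) ->
  0 < amin ->
  (forall y x, Gam lo hi y -> D x -> amin <= coef a0 an y x <= amax) ->
  mesh D Tinit ->
  (forall y T, Gam lo hi y -> Tinit T ->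
     weak_gradient_Linfty (interior T) (coef a0 an y)) ->
  parametric_solution D (Gam lo hi) (coef a0 an) f u ->
  P = workless_profit D lo hi (coef a0 an) u \/
  P = work_profit D lo hi (coef a0 an) u ->
  SC_sequence P I ->
  zeta_SC D lo hi (coef a0 an) u (I l) @[l --> \oo] --> 0%E /\
  error D lo hi u (I l) @[l --> \oo] --> 0%E.
Proof.
move=> _ N1 [oD _ D0 _ _] lohi _ ma0 man amin0 coefb _ _ solu hP SC.
exact: (SC_convergence N1 oD D0 lohi ma0 man amin0 coefb solu hP SC).
Qed.
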